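(* For any $3$-uniform hypergraph $H=(V,E)$ and any preference system $(\succeq_v)_{v\in V}$ for $H$, there exists a stable set of edges $\{e_1,e_2,\ldots,e_m\}\subseteq E$ with $m\le \frac{|V|}{2}$.
   Context: A hypergraph $H=(V,E)$ consists of a non-empty finite set $V$ of vertices and a family $E$ of subsets of $V$ called edges; all edges are non-empty and every vertex belongs to at least one edge. $H$ is $3$-uniform if $|e|=3$ for every $e\in E$. For $v\in V$ let $E_v=\{e\in E: v\in e\}$. A preference system for $H$ is a family $(\succeq_v)_{v\in V}$ where each $\succeq_v$ is a (reflexive) linear order on $E_v$; $e\succeq_v e'$ means that $v$ weakly prefers $e$ to $e'$. A set of edges $\{e_1,\ldots,e_m\}\subseteq E$ (not required to be pairwise disjoint) dominates an edge $e\in E$ at a vertex $v\in e$ if for some $1\le i\le m$ we have $v\in e_i$ and $e_i\succeq_v e$. The set $\{e_1,\ldots,e_m\}$ is stable if it dominates every edge $e\in E$ at some $v\in e$. *)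

(* Defs.v *)
From mathcomp Require Import all_boot.

Set Implicit Arguments.
Unset Strict Implicit.
Unset Printing Implicit Defensive.

(* A hypergraph with vertex set the finite type V is given by its edge set E. *)
Definition hypergraph (V : finType) (E : {set {set V}}) : Prop :=
  [/\ 0 < #|V|,
      forall e : {set V}, e \in E -> e != set0
    & forall v : V, exists2 e : {set V}, e \in E & v \in e].

Definition uniform (k : nat) (V : finType) (E : {set {set V}}) : Prop :=
  forall e : {set V}, e \in E -> #|e| = k.

Definition edges_at (V : finType) (E : {set {set V}}) (v : V) : {set {set V}} :=
  [set e in E | v \in e].

(* Only the restriction of r to A is constrained. *)
Definition linear_order_on (T : finType) (A : {set T}) (r : rel T) : Prop :=
  [/\ {in A, reflexive r},
      {in A &, antisymmetric r},
      {in A & &, transitive r}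
    & {in A &, total r}].

(* [pref v e f] reads: v weakly prefers e to f. *)
Definition preference_system (V : finType) (E : {set {set V}})
    (pref : V -> rel {set V}) : Prop :=
  forall v : V, linear_order_on (edges_at E v) (pref v).

Definition dominates_at (V : finType) (pref : V -> rel {set V})
    (S : {set {set V}}) (e : {set V}) (v : V) : Prop :=
  exists f : {set V}, [/\ f \in S, v \in f & pref v f e].

Definition stable (V : finType) (E : {set {set V}}) (pref : V -> rel {set V})
    (S : {set {set V}}) : Prop :=
  forall e : {set V}, e \in E -> exists2 v : V, v \in e & dominates_at pref S e v.

(* Main.v *)
Require Import Defs.
From mathcomp Require Import all_boot.
From mathcomp Require Import all_order all_algebra.
From mathcomp Require Import boolp.
From mathcomp Require Import zify ring lra.

(* Scarf's lemma gives weights x on the edges that are a fractional matching (up to a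
   small perturbation making the linear program nondegenerate) such that every edge e
   has a vertex v whose incident weights add up to at least 1 and for which every edge
   of the support at v is weakly preferred to e. Hence any set of support edges covering
   the set S of these saturated vertices is stable. As the total weight w of x is about
   |V|/3 at most, it suffices to cover S by at most w + |S|/6 edges.

   This is proved for families B of sets of size at most 3 that are closed under
   subsets: if x is a fractional partition of S into sets of B, then the least number
   tau S of sets of B partitioning S satisfies 6 tau S <= |S| + 6 w. In a minimal
   counterexample S, deleting blocks shows x < 1/2 on triples, < 2/3 on pairs, < 5/6 on
   singletons, and deleting vertices shows tau (S - u) < tau S, so 2 tau S = |S| + 1 by
   an analogue of Gallai's lemma. For a heavy triple t (x t >= 1/3) the graph S - t has
   exactly two components C ("lobes") with 2 tau C = |C| + 1. In a lobe that is minimal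
   among the lobes of all heavy triples, all vertices but at most one are "light": they
   lie in no triple of weight > 1/3 and in at most one of weight 1/3. Finally x may be
   chosen with at most |S| sets in its support; distributing over the vertices a charge
   of about 6 from each set of the support then leaves room for at most three light
   vertices, but two disjoint minimal lobes provide four. *)

Set Implicit Arguments.
Unset Strict Implicit.
Unset Printing Implicit Defensive.

Import Order.TTheory GRing.Theory Num.Theory.

(** * Optimal packings by small blocks *)

Section Packings.

Variables (V : finType) (B : {set {set V}}).
Hypothesis B_down : forall X Y : {set V}, X \in B -> Y \subset X -> Y \in B.
Hypothesis B_single : forall v, [set v] \in B.

Implicit Types (S A C X Y : {set V}) (P Q : {set {set V}}).

Definition packing S P := partition P S && (P \subset B).

Definition singletons S : {set {set V}} := [set [set v] | v in S].

Definition tau S := #|[arg min_(P < singletons S | packing S P) #|P|]|.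

Lemma packing_singletons S : packing S (singletons S).
Proof.
apply/andP; split; last by apply/subsetP => _ /imsetP[v _ ->].
apply/and3P; split.
- apply/eqP/setP => v; apply/bigcupP/idP => [[_ /imsetP[u uS ->]]|vS].
    by rewrite inE => /eqP->.
  by exists [set v]; rewrite ?set11 //; apply: imset_f.
- apply/trivIsetP => _ _ /imsetP[u _ ->] /imsetP[v _ ->] uv.
  by rewrite disjoints1 inE; apply: contraNneq uv => ->.
- by apply/imsetP => -[v _ /setP/(_ v)]; rewrite !inE eqxx.
Qed.

Lemma tau_packing S : exists2 P, packing S P & #|P| = tau S.
Proof.
rewrite /tau; case: arg_minnP => [|P pP _]; first exact: packing_singletons.
by exists P.
Qed.

Lemma tau_min S P : packing S P -> tau S <= #|P|.
Proof.
rewrite /tau; case: arg_minnP => [|Q _ Qmin]; first exact: packing_singletons.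
exact: Qmin.
Qed.

(** Assigning each vertex of [S] to one member of [P] that contains it gives a partition whose
    blocks are subsets of members of [P], hence lie in [B] by [B_down]. So [tau] can be bounded by
    covers, without checking disjointness. *)
Lemma tau_cover S P : P \subset B -> S \subset cover P -> tau S <= #|P|.
Proof.
move=> PB SP; pose f v := odflt set0 [pick X in P | v \in X].
have fP v : v \in S -> f v \in P /\ v \in f v.
  move=> /(subsetP SP)/bigcupP[X XP vX]; rewrite /f.
  by case: pickP => [Y /andP[]//|/(_ X)]; rewrite XP vX.
apply: leq_trans (tau_min (P := preim_partition f S) _) _.
  rewrite /packing preim_partitionP; apply/subsetP => _ /imsetP[u uS ->].
  have [fuP _] := fP u uS; apply: B_down (subsetP PB _ fuP) _.
  apply/subsetP => v; rewrite !inE => /andP[vS /eqP->].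
  by case: (fP v vS).
apply: leq_trans (_ : #|f @: S| <= _); last first.
  by apply/subset_leq_card/subsetP => _ /imsetP[v vS ->]; case: (fP v vS).
have -> : preim_partition f S = (fun X => [set y in S | X == f y]) @: (f @: S).
  by rewrite -imset_comp.
exact: leq_imset_card.
Qed.

Lemma packing_cover S P : packing S P -> cover P = S.
Proof. by case/andP => /cover_partition. Qed.

Lemma packing_sub S P X : packing S P -> X \in P -> X \subset S.
Proof. by move=> /packing_cover <- XP; apply: bigcup_sup XP. Qed.

Lemma packing_in S P X : packing S P -> X \in P -> X \in B.
Proof. by case/andP => _ /subsetP PB /PB. Qed.

Lemma packing_block S P v : packing S P -> v \in S -> exists2 X, X \in P & v \in X.
Proof. by move=> /packing_cover <- /bigcupP[X]; exists X. Qed.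

Lemma packing_uniq S P X Y v : packing S P -> X \in P -> Y \in P ->
  v \in X -> v \in Y -> X = Y.
Proof.
case/andP => /and3P[_ tP _] _ XP YP vX vY; apply/eqP; apply: contraT => XY.
have /trivIsetP/(_ X Y XP YP XY)/pred0P/(_ v) := tP.
by rewrite /= vX vY.
Qed.

Lemma packing_neq0 S P X : packing S P -> X \in P -> X != set0.
Proof. by case/andP => /and3P[_ _ P0] _; apply: contraTneq => ->. Qed.

Lemma tauU A C : tau (A :|: C) <= tau A + tau C.
Proof.
have [P pP <-] := tau_packing A; have [Q pQ <-] := tau_packing C.
apply: leq_trans (_ : #|P :|: Q| <= _); last by rewrite cardsU leq_subr.
apply: tau_cover; first by rewrite subUset; case/andP: pP => _ ->; case/andP: pQ.
by rewrite /cover bigcup_setU -/(cover P) -/(cover Q) (packing_cover pP) (packing_cover pQ).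
Qed.

Lemma tau_block S X : X \in B -> tau S <= (tau (S :\: X)).+1.
Proof.
move=> XB; have [P pP <-] := tau_packing (S :\: X).
apply: leq_trans (_ : #|X |: P| <= _); last by rewrite cardsU1; case: (X \notin P).
apply: tau_cover.
  by rewrite subUset sub1set XB; case/andP: pP.
rewrite /cover bigcup_setU big_set1 -/(cover P) (packing_cover pP).
by apply/subsetP => v vS; rewrite !inE vS andbT orbN.
Qed.

(** As [B] is closed under subsets, testing pairs suffices to exclude every block meeting both
    sets. *)
Definition separated A C := [forall u in A, forall v in C, [set u; v] \notin B].

Lemma separatedP A C :
  reflect {in A & C, forall u v, [set u; v] \notin B} (separated A C).
Proof.
apply: (iffP forall_inP) => [H u v uA vC|H u uA].
  by have /forall_inP := H u uA; apply.
by apply/forall_inP => v; apply: H.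
Qed.

(** Each block of an optimal packing of the union meets at most one of the two sets, so the packing
    splits. *)
Lemma tau_separated A C : separated A C -> tau A + tau C <= tau (A :|: C).
Proof.
move=> /separatedP AC; have [P pP <-] := tau_packing (A :|: C).
pose PA D := [set X in P | X :&: D != set0].
have tauPA (D : {set V}) : D \subset A :|: C -> tau D <= #|PA D|.
  move=> DAC; apply: tau_cover.
    by apply/subsetP => X; rewrite inE => /andP[/(packing_in pP)].
  apply/subsetP => v vD; have [X XP vX] := packing_block pP (subsetP DAC v vD).
  apply/bigcupP; exists X => //; rewrite inE XP; apply/set0Pn; exists v.
  by rewrite inE vX.
apply: leq_trans (leq_add (tauPA _ (subsetUl _ _)) (tauPA _ (subsetUr _ _))) _.
rewrite -cardsUI [X in _ + X](_ : _ = 0) ?addn0.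
  by apply/subset_leq_card/subsetP => X; rewrite !inE -andb_orr => /andP[].
apply/eqP; rewrite cards_eq0; apply/set0Pn => -[X]; rewrite !inE.
case/andP => /andP[XP /set0Pn[u /setIP[uX uA]]] /andP[_ /set0Pn[v /setIP[vX vC]]].
have /negP[] := AC u v uA vC; apply: B_down (packing_in pP XP) _.
by apply/subsetP => w; rewrite !inE => /orP[]/eqP->.
Qed.

(** These vertices play the role of the vertices missed by a matching. *)
Definition singles P : {set V} := [set v | [set v] \in P].

Lemma two_tau_le S P : packing S P -> 2 * #|P| <= #|S| + #|singles P|.
Proof.
move=> pP; have [/card_partition -> _] := andP pP.
have -> : #|singles P| = \sum_(X in P) (#|X| == 1).
  rewrite (bigID (fun X => #|X| == 1)) /= [X in _ + X]big1 ?addn0; last first.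
    by move=> X /andP[_ /negbTE->].
  rewrite (eq_bigr (fun=> 1)) => [|X /andP[_ ->]//]; rewrite sum1_card.
  rewrite -(card_imset (singles P) set1_inj); apply: eq_card => X.
  apply/imsetP/andP => [[v vP ->]|[XP /cards1P[v Xv]]].
    by rewrite cards1; move: vP; rewrite inE.
  by exists v; rewrite // inE -Xv.
rewrite -big_split /= mulnC -sum_nat_const; apply: leq_sum => X XP.
have := packing_neq0 pP XP; rewrite -card_gt0.
by case: #|X| => [|[|n]].
Qed.

Definition insert_block Y P : {set {set V}} :=
  Y |: ([set X :\: Y | X in P] :\ set0).

(** Cutting [Y] out of all blocks empties the block [[set z]]; dropping that block pays for the new
    block [Y]. *)
Lemma packing_insert S P Y z : packing S P -> Y \in B -> Y \subset S -> z \in Y ->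
  [set z] \in P -> packing S (insert_block Y P) /\ #|insert_block Y P| <= #|P|.
Proof.
move=> pP YB YS zY zP; split.
  apply/andP; split; last first.
    apply/subsetP => X; rewrite !inE => /orP[/eqP->//|/andP[_ /imsetP[W WP ->]]].
    by apply: B_down (packing_in pP WP) _; apply: subsetDl.
  apply/and3P; split.
  - apply/eqP/setP => v; apply/bigcupP/idP => [[X]|vS].
      rewrite !inE => /orP[/eqP->|/andP[_ /imsetP[W WP ->]]]; first exact: (subsetP YS).
      by case/setDP => vW _; apply: (subsetP (packing_sub pP WP)).
    have [vY|vY] := boolP (v \in Y); first by exists Y; rewrite // setU11.
    have [W WP vW] := packing_block pP vS; exists (W :\: Y); last by rewrite inE vY.
    rewrite !inE (imset_f (fun X => X :\: Y) WP) andbT; apply/orP; right.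
    by apply/set0Pn; exists v; rewrite inE vY.
  - apply/trivIsetP => X X'; rewrite !inE.
    have dY W : [disjoint Y & W :\: Y].
      by apply/pred0P => v /=; rewrite inE; case: (v \in Y).
    case/orP => [/eqP->|/andP[_ /imsetP[W WP ->]]];
    case/orP => [/eqP->|/andP[_ /imsetP[W' WP' ->]]]; rewrite ?eqxx // => XX'.
      by rewrite disjoint_sym.
    apply/pred0P => v /=; apply/negP => /andP[/setDP[vW _] /setDP[vW' _]].
    by move: XX'; rewrite (packing_uniq pP WP WP' vW vW') eqxx.
  - rewrite !inE eqxx orbF eq_sym; apply/set0Pn; by exists z.
rewrite (cardsD1 [set z] P) zP.
apply: leq_trans (_ : 1 + #|[set X :\: Y | X in P :\ [set z]]| <= _); last first.
  by rewrite leq_add2l leq_imset_card.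
rewrite /insert_block cardsU1 leq_add //; first by case: (Y \notin _).
apply/subset_leq_card/subsetP => X; rewrite !inE => /andP[X0 /imsetP[W WP XW]].
apply/imsetP; exists W => //; rewrite !inE WP andbT; apply: contraNneq X0 => Wz.
rewrite XW Wz -subset0; apply/subsetP => v; rewrite !inE => /andP[vY /eqP vz].
by rewrite vz zY in vY.
Qed.

End Packings.

(** * Exchanges, components and the Gallai-type bound *)

Section Components.

Variables (V : finType) (B : {set {set V}}).
Hypothesis B_down : forall X Y : {set V}, X \in B -> Y \subset X -> Y \in B.
Hypothesis B_single : forall v, [set v] \in B.

Implicit Types (S A C X Y : {set V}) (P Q : {set {set V}}).

Local Notation packing := (packing B).
Local Notation tau := (tau B).
Local Notation separated := (separated B).

Definition good S P : Prop :=
  [/\ packing S P, #|P| = tau S &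
      forall Q, packing S Q -> #|Q| = tau S -> #|singles P| <= #|singles Q|].

Lemma good_exists S : exists P, good S P.
Proof.
have [P0 pP0 cP0] := tau_packing B_single S.
pose opt Q := packing S Q && (#|Q| == tau S).
have oP0 : opt P0 by rewrite /opt pP0 cP0 eqxx.
have [P /andP[pP /eqP cP] Pmin] := arg_minnP (fun Q => #|singles Q|) oP0.
by exists P; split=> // Q pQ cQ; apply: Pmin; rewrite /opt pQ cQ eqxx.
Qed.

(** Otherwise the two singleton blocks could be merged into one, giving a smaller packing. *)
Lemma singles_nonadjacent S P u v : packing S P -> #|P| = tau S ->
  u \in singles P -> v \in singles P -> u != v -> [set u; v] \notin B.
Proof.
rewrite !inE => pP cP uP vP uv; apply/negP => uvB.
suff : tau S < tau S by rewrite ltnn.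
rewrite -{2}cP (cardsD1 [set u]) uP (cardsD1 [set v]) !inE vP andbT.
have -> : [set v] != [set u] by apply: contraNneq uv => /set1_inj->.
rewrite !add1n ltnS.
apply: leq_trans (_ : #|[set u; v] |: P :\ [set u] :\ [set v]| <= _); last first.
  by rewrite cardsU1; case: (_ \notin _).
apply: (tau_cover B_down B_single).
  rewrite subUset sub1set uvB; apply/subsetP => X; rewrite !inE => /and3P[_ _].
  exact: packing_in pP.
apply/subsetP => w wS; have [X XP wX] := packing_block pP wS.
apply/bigcupP; have [wuv|wuv] := boolP (w \in [set u; v]).
  by exists [set u; v]; rewrite // setU11.
exists X => //; rewrite !inE XP andbT; apply/orP; right; move: wuv.
rewrite !inE negb_or => /andP[wu wv]; apply/andP; split.
  by apply: contraNneq wv => Xv; move: wX; rewrite Xv inE.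
by apply: contraNneq wu => Xu; move: wX; rewrite Xu inE.
Qed.

Lemma packing_add1 S P w : w \in S -> packing (S :\ w) P ->
  packing S ([set w] |: P).
Proof.
move=> wS pP; apply/andP; split; last first.
  by rewrite subUset sub1set B_single; case/andP: pP.
have wX X : X \in P -> w \notin X.
  by move=> /(packing_sub pP)/subsetP XS; apply/negP => /XS; rewrite !inE eqxx.
apply/and3P; split.
- apply/eqP; rewrite /cover bigcup_setU big_set1 -/(cover P) (packing_cover pP).
  exact: setD1K.
- apply/trivIsetP => X Y; rewrite !inE.
  case/orP => [/eqP->|XP]; case/orP => [/eqP->|YP]; rewrite ?eqxx // => XY.
  + by rewrite disjoints1 wX.
  + by rewrite disjoint_sym disjoints1 wX.
  + apply/pred0P => v /=; apply/negP => /andP[vX vY].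
    by rewrite (packing_uniq pP XP YP vX vY) eqxx in XY.
- rewrite !inE negb_or eq_sym; apply/andP; split.
    by apply/set0Pn; exists w; rewrite set11.
  by case/andP: pP => /and3P[].
Qed.

(* Among optimal packings having w as a single, the one sharing most blocks with P
   has all its other singles in common with P: otherwise a block of P could be inserted. *)
Lemma move_single S P u w : good S P -> u \in singles P -> w \in S -> u != w ->
  [set u; w] \in B -> tau (S :\ w) < tau S ->
  exists2 Q, good S Q & singles Q = w |: singles P :\ u.
Proof.
move=> [pP cP Pmin] uP wS uw uwB tauw.
have [Q0 pQ0 cQ0] := tau_packing B_single (S :\ w).
pose opt Q := [&& packing S Q, #|Q| == tau S & [set w] \in Q].
have optQ0 : opt ([set w] |: Q0).
  have pQ := packing_add1 wS pQ0; rewrite /opt pQ setU11 andbT /=.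
  rewrite eqn_leq (tau_min B_single pQ) andbT.
  by rewrite cardsU1 cQ0; case: (_ \notin _); rewrite ?add1n ?add0n // ltnW.
have [Q /and3P[pQ /eqP cQ wQ] Qmax] := arg_maxnP (fun Q => #|P :&: Q|) optQ0.
have singlesQ z : z \in singles Q -> z != w -> z \in singles P.
  move=> zQ zw; apply: contraT => zP; have zQ' : [set z] \in Q by rewrite inE in zQ.
  have zS : z \in S by apply: (subsetP (packing_sub pQ zQ')); rewrite set11.
  have [Y YP zY] := packing_block pP zS.
  have [pI cI] := packing_insert B_down pQ (packing_in pP YP) (packing_sub pP YP) zY zQ'.
  have wY : w \notin Y.
    have := singles_nonadjacent pQ cQ zQ _ zw; rewrite inE => /(_ wQ).
    apply: contraNN => wY; apply: B_down (packing_in pP YP) _.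
    by apply/subsetP => v; rewrite !inE => /orP[]/eqP->.
  have YQ : Y \notin Q.
    apply: contraNN zP => YQ; rewrite inE.
    by rewrite -(packing_uniq pQ YQ zQ' zY (set11 z)).
  have keep X : X \in Q -> [disjoint X & Y] -> X \in insert_block Y Q.
    move=> XQ /setDidPl XY; rewrite !inE (packing_neq0 pQ XQ) /=.
    by apply/orP; right; apply/imsetP; exists X.
  suff : #|P :&: Q| < #|P :&: Q| by rewrite ltnn.
  apply: leq_trans (Qmax (insert_block Y Q) _); last first.
    rewrite /opt pI eqn_leq (tau_min B_single pI) -cQ cI /=.
    by apply: keep => //; rewrite disjoints1.
  apply: proper_card; apply/properP; split.
    apply/subsetP => X /setIP[XP XQ]; rewrite inE XP keep //.
    apply/pred0P => v /=; apply/negP => /andP[vX vY].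
    by rewrite -(packing_uniq pP XP YP vX vY) XQ in YQ.
  by exists Y; rewrite !inE ?YP ?eqxx // negb_and YQ orbT.
have wQ' : w \in singles Q by rewrite inE.
have uQ : u \notin singles Q.
  by apply/negP => uQ; move: (singles_nonadjacent pQ cQ uQ wQ' uw); rewrite uwB.
have wP : w \notin singles P.
  by apply/negP => wP; move: (singles_nonadjacent pP cP uP wP uw); rewrite uwB.
have sQ : singles Q \subset w |: singles P :\ u.
  apply/subsetP => z zQ; rewrite in_setU1 in_setD1.
  have [//|zw] := eqVneq z w; rewrite singlesQ // andbT /=.
  by apply: contraNneq uQ => <-.
have cPu : #|w |: singles P :\ u| = #|singles P|.
  by rewrite cardsU1 in_setD1 negb_and wP orbT (cardsD1 u (singles P)) uP.
have eQ : singles Q = w |: singles P :\ u.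
  by apply/eqP; rewrite eqEcard sQ cPu Pmin.
exists Q => //; split=> // Q' pQ' cQ'.
by rewrite eQ cPu; apply: Pmin.
Qed.

Definition adj A : rel V := [rel u v | [&& u \in A, v \in A & [set u; v] \in B]].

Lemma adj_sym A : symmetric (adj A).
Proof. by move=> u v; rewrite /adj /= andbCA setUC. Qed.

Lemma connect_adj_sym A : connect_sym (adj A).
Proof. exact/sym_connect_sym/adj_sym. Qed.

Definition connected A := {in A &, forall u v, connect (adj A) u v}.

(** If a good packing had two singles, [move_single] would shift one of them along a path towards
    the other until they are adjacent, contradicting [singles_nonadjacent]. With at most one single,
    [two_tau_le] gives the bound. *)
Lemma gallai A : connected A -> {in A, forall u, tau (A :\ u) < tau A} ->
  2 * tau A <= #|A|.+1.
Proof.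
move=> Aconn iness; have [P gP] := good_exists A; have [pP cP _] := gP.
rewrite -cP; apply: leq_trans (two_tau_le pP) _; rewrite -addn1 leq_add2l leqNgt.
apply/negP => /card_gt1P[u [v [uP vP uv]]].
have inA z Q : packing A Q -> z \in singles Q -> z \in A.
  by rewrite inE => pQ /(packing_sub pQ)/subsetP; apply; rewrite set11.
have [p] := connectP (Aconn u v (inA _ _ pP uP) (inA _ _ pP vP)).
elim: p u P gP uP vP uv {pP cP} => [|w p IHp] u P gP uP vP uv /=.
  by move=> _ vu; rewrite vu eqxx in uv.
case/andP => /and3P[uA wA uwB] wp vE.
have [uw|uw] := eqVneq u w; first by subst w; apply: (IHp u P).
have [pP cP _] := gP.
have wv : w != v.
  by apply: contraTneq uwB => ->; exact: (singles_nonadjacent pP cP uP vP uv).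
have [Q gQ eQ] := move_single gP uP wA uw uwB (iness w wA).
apply: (IHp w Q) => //; first by rewrite eQ setU11.
by rewrite eQ in_setU1 in_setD1 [v == u]eq_sym uv vP orbT.
Qed.

Definition component A u := [set v in A | connect (adj A) u v].

Definition components A := equivalence_partition (connect (adj A)) A.

Lemma components_partition A : partition (components A) A.
Proof.
apply: equivalence_partitionP => u v w _ _ _; split; first exact: connect0.
by move=> uv; apply: (same_connect (connect_adj_sym A) uv).
Qed.

Lemma componentsP A C : reflect (exists2 u, u \in A & C = component A u) (C \in components A).
Proof. exact: imsetP. Qed.

Lemma component_sub A C : C \in components A -> C \subset A.
Proof.
by case/componentsP => u _ ->; apply/subsetP => v; rewrite inE => /andP[].
Qed.

Lemma component_closed A C u v : C \in components A -> u \in C -> v \in A ->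
  [set u; v] \in B -> v \in C.
Proof.
case/componentsP => w wA ->; rewrite !inE => /andP[uA wu] vA uvB; rewrite vA.
by apply: connect_trans wu (connect1 _); rewrite /adj /= uA vA.
Qed.

Lemma component_separated A C : C \in components A -> separated C (A :\: C).
Proof.
move=> CA; apply/separatedP => u v uC /setDP[vA]; apply: contraNN.
exact: component_closed CA uC vA.
Qed.

Lemma component_connected A C : C \in components A -> connected C.
Proof.
case/componentsP => w wA CE.
suff wC v : v \in C -> connect (adj C) w v.
  move=> u v uC vC; apply: connect_trans (wC v vC).
  by rewrite connect_adj_sym wC.
rewrite CE inE => /andP[vA /connectP[p]].
elim/last_ind: p v vA => [|p x IHp] v vA /=; first by move=> _ ->; apply: connect0.
rewrite rcons_path last_rcons => /andP[wp /and3P[lA xA lx]] ->.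
have wl : connect (adj A) w (last w p) by apply/connectP; exists p.
apply: connect_trans (IHp _ lA wp erefl) (connect1 _).
rewrite /adj /= !inE lA wl lx xA /= andbT; apply: connect_trans wl (connect1 _).
by rewrite /adj /= lA xA.
Qed.

Lemma connected_in_component A C D u : D \in components A -> C \subset A ->
  connected C -> u \in C -> u \in D -> C \subset D.
Proof.
case/componentsP => w _ -> CA Cconn uC; rewrite inE => /andP[uA wu].
apply/subsetP => v vC; rewrite inE (subsetP CA v vC) /=.
apply: connect_trans wu _; apply: connect_sub (Cconn u v uC vC) => x y /and3P[xC yC xy].
by apply: connect1; rewrite /adj /= !(subsetP CA).
Qed.

Lemma components_uniq A C D u : C \in components A -> D \in components A ->
  u \in C -> u \in D -> C = D.
Proof.
move=> CA DA uC uD; apply/eqP; rewrite eqEsubset.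
rewrite (connected_in_component DA (component_sub CA) (component_connected CA) uC uD).
by rewrite (connected_in_component CA (component_sub DA) (component_connected DA) uD uC).
Qed.

Lemma component_neq0 A C : C \in components A -> exists u, u \in C.
Proof. by case/componentsP => u uA ->; exists u; rewrite inE uA connect0. Qed.

Lemma component_cover A u : u \in A -> exists2 C, C \in components A & u \in C.
Proof.
move=> uA; exists (component A u); last by rewrite inE uA connect0.
by apply/componentsP; exists u.
Qed.

(** [tau] is additive over [C] and the rest of [A], which are separated, and deleting [u] affects
    only the summand of [C]. *)
Lemma component_inessential A C : {in A, forall u, tau (A :\ u) < tau A} ->
  C \in components A -> {in C, forall u, tau (C :\ u) < tau C}.
Proof.
move=> iness CA u uC; have CsubA := component_sub CA.
have uA := subsetP CsubA u uC.
have CU : C :|: (A :\: C) = A by rewrite setDE setUIr setUCr setIT; apply/setUidPr.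
have := tauU B_down B_single C (A :\: C); rewrite CU.
have : tau (C :\ u) + tau (A :\: C) <= tau (A :\ u).
  have -> : A :\ u = (C :\ u) :|: (A :\: C).
    apply/setP => v; rewrite !inE; have [->|vu] /= := eqVneq v u; first by rewrite uC.
    by have [/(subsetP CsubA)->|] := boolP (v \in C).
  apply: (tau_separated B_down B_single).
  apply/separatedP => x y /setD1P[_ xC]; move: x y xC.
  by move/separatedP: (component_separated CA) => sepC x y; apply: sepC.
by have := iness u uA; lia.
Qed.

Definition lobes A := [set C in components A | 2 * tau C == #|C|.+1].

(** By subadditivity and [gallai], a component contributes at most [#|C|] to [2 * tau A], and one
    more only if it is a lobe. An excess of 2 over [#|A|] therefore needs two lobes. *)
Lemma two_lobes A : {in A, forall u, tau (A :\ u) < tau A} ->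
  #|A|.+2 <= 2 * tau A -> 1 < #|lobes A|.
Proof.
move=> iness; have pA := components_partition A.
have tau0 : tau set0 = 0.
  apply/eqP; rewrite -leqn0 -[X in _ <= X](cards0 {set V}).
  by apply: (tau_cover B_down B_single); rewrite ?sub0set.
have le : 2 * tau A <= \sum_(C in components A) (#|C| + (2 * tau C == #|C|.+1)).
  have : tau (\bigcup_(C in components A) C) <= \sum_(C in components A) tau C.
    apply: (big_ind2 (fun X n => tau X <= n)) => [|X m Y n Xm Yn|//].
      by rewrite tau0.
    by apply: leq_trans (tauU B_down B_single _ _) (leq_add Xm Yn).
  rewrite -/(cover _) (cover_partition pA) => H.
  apply: leq_trans (_ : 2 * \sum_(C in components A) tau C <= _).
    by rewrite leq_mul2l.
  rewrite big_distrr; apply: leq_sum => C CA.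
  have := gallai (component_connected CA) (component_inessential iness CA).
  by case: eqP => //=; lia.
move=> tauA; have := leq_trans tauA le; rewrite big_split /=.
rewrite -(card_partition pA) -addn2 leq_add2l.
suff -> : #|lobes A| = \sum_(C in components A) (2 * tau C == #|C|.+1) by [].
rewrite -sum1_card big_mkcond [RHS]big_mkcond; apply: eq_bigr => C _.
by rewrite inE; case: (C \in _); case: eqP.
Qed.

End Components.

(** * Scarf's lemma *)

Section DominatingSets.

Variables (V J : finType) (c : V -> J -> nat).

(** Scarf's notion for the matrix [c]: every column is, in some row, at most the minimum of that row
    over [D]. *)
Definition dominating (D : {set J}) : bool :=
  [forall j, exists v, forall d in D, c v j <= c v d].

Lemma dominatingP (D : {set J}) :
  reflect (forall j, exists v, {in D, forall d, c v j <= c v d}) (dominating D).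
Proof.
apply: (iffP forallP) => H j; have := H j.
  by case/existsP => v /forall_inP; exists v.
by case=> v Hv; apply/existsP; exists v; apply/forall_inP.
Qed.

Hypothesis c_inj : forall v, injective (c v).

Definition row_min (D : {set J}) (m : V -> J) : Prop :=
  forall v, m v \in D /\ {in D, forall d, c v (m v) <= c v d}.

Lemma row_min_exists (D : {set J}) : D != set0 -> exists m, row_min D m.
Proof.
case/set0Pn => d dD.
exists (fun v => [arg min_(j < d | j \in D) c v j]) => v.
by case: arg_minnP.
Qed.

Lemma row_min_uniq (D : {set J}) (m : V -> J) v d : row_min D m ->
  d \in D -> {in D, forall d', c v d <= c v d'} -> m v = d.
Proof.
move=> mD dD dmin; apply: (@c_inj v); have [mvD mv] := mD v.
by apply/eqP; rewrite eqn_leq mv //= dmin.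
Qed.

(* In a dominating set of size #|V| every element is the minimum of exactly one row. *)
Lemma dominating_row (Y : {set J}) (m : V -> J) j : row_min Y m ->
  #|Y|.+1 = #|V| -> j \notin Y -> dominating (j |: Y) ->
  exists r, [/\ c r j < c r (m r), {in predC1 r &, injective m},
    forall v, v != r -> c v (m v) < c v j &
    {in Y, forall y, exists2 v, v != r & m v = y}].
Proof.
move=> mY cY jY dY; set D := j |: Y in dY.
have cD : #|D| = #|V| by rewrite cardsU1 jY.
have jD : j \in D by rewrite setU11.
have YD y : y \in Y -> y \in D by apply: setU1r.
have [|mD mDP] := @row_min_exists D; first by apply/set0Pn; exists j.
have imD : mD @: setT = D.
  apply/setP => d; apply/imsetP/idP => [[v _ ->]|dD]; first by case: (mDP v).
  have [v vP] := dominatingP _ dY d; exists v => //.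
  by rewrite (row_min_uniq mDP dD).
have mDinj : injective mD.
  move=> u v; apply: (imset_injP (D := [set: V]) (f := mD)) => //.
  by rewrite imD cD cardsT.
have [r _ rj] : exists2 r, r \in [set: V] & j = mD r by apply/imsetP; rewrite imD.
have mE v : v != r -> m v = mD v.
  move=> vr; have [mvD mv] := mDP v.
  apply: (row_min_uniq mY) => [|y yY]; last exact/mv/YD.
  move: mvD; rewrite in_setU1 => /orP[|//].
  by rewrite rj (inj_eq mDinj) (negbTE vr).
exists r; split.
- rewrite ltn_neqAle (inj_eq (@c_inj r)); have [mrY _] := mY r.
  apply/andP; split; first by apply: contraNneq jY => ->.
  by rewrite {1}rj; case: (mDP r) => _; apply; apply: YD.
- by move=> u v ur vr; rewrite !mE //; apply: mDinj.
- move=> v vr; rewrite ltn_neqAle (inj_eq (@c_inj v)) mE //.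
  by rewrite {1}rj (inj_eq mDinj) vr; case: (mDP v) => _; apply.
- move=> y yY; have : y \in mD @: setT by rewrite imD YD.
  case/imsetP => v _ yv; suff vr : v != r by exists v; rewrite // mE.
  by apply: contraNneq jY => vr; rewrite rj -vr -yv.
Qed.

(** Outside row [r] the minimum over [Y] lies strictly below both columns, so each of them can be
    dominated by the set of the other only in row [r]. The two resulting inequalities force
    equality. *)
Lemma dominating_same_row (Y : {set J}) (m : V -> J) r j k : row_min Y m ->
  dominating (j |: Y) -> dominating (k |: Y) ->
  (forall v, v != r -> c v (m v) < c v j) ->
  (forall v, v != r -> c v (m v) < c v k) -> j = k.
Proof.
move=> mY; suff le j' k' : dominating (j' |: Y) ->
    (forall v, v != r -> c v (m v) < c v k') -> c r k' <= c r j'.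
  move=> dj dk jr kr; apply: (@c_inj r); apply/eqP.
  by rewrite eqn_leq !le.
move=> /dominatingP/(_ k')[v vP] kr; have [<-|vr] := eqVneq v r.
  by apply: vP; rewrite setU11.
have [mvY _] := mY v; have := vP (m v) (setU1r _ mvY).
by rewrite leqNgt kr.
Qed.

(** The ordinal pivot: there are no completions of [Y] or exactly two. A completion belongs to a row
    off which the row minima of [Y] are distinct; as the rows [r1] and [r2] share their minimum,
    only these two qualify, and each admits one completion. *)
Lemma even_dominating (Y : {set J}) (s : V -> J) e : e \in Y ->
  (forall v r, v != r -> c v e < c v (s r)) -> #|Y|.+1 = #|V| ->
  ~~ odd #|[set j | (j \notin Y) && dominating (j |: Y)]|.
Proof.
move=> eY es cY; set F := [set _ | _].
have [->|[j]] := set_0Vmem F; first by rewrite cards0.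
rewrite inE => /andP[jY dj].
have [|m mY] := @row_min_exists Y; first by apply/set0Pn; exists e.
have [r1 [jr1 inj1 Kj surj]] := dominating_row mY cY jY dj.
have [r2 r2r1 mr2] := surj _ (mY r1).1.
pose K := [pred k | [forall (v | v != r2), c v (m v) < c v k]].
(* Here [e] is needed: outside row [r2] it lies below [s r2], and the row minima of [Y] lie weakly
   below [e], so [K] is not empty. *)
have Ks : K (s r2).
  apply/forall_inP => v vr; apply: leq_ltn_trans (es _ _ vr).
  by case: (mY v) => _; apply.
have [k /forall_inP kK kmax] := arg_maxnP (c r2) Ks.
have kY : k \notin Y.
  apply/negP => /surj[v vr1 mvk].
  have [vr2|vr2] := eqVneq v r2; last by have := kK _ vr2; rewrite mvk ltnn.
  have := kK r1; rewrite eq_sym r2r1 -mr2 -vr2 mvk => /(_ isT).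
  by rewrite ltnn.
have kj : k != j.
  apply/eqP => kj; have := kK r1; rewrite eq_sym r2r1 kj => /(_ isT).
  by rewrite ltnNge ltnW.
have dk : dominating (k |: Y).
  apply/dominatingP => l; have [lK|lK] := boolP (K l).
    exists r2 => d; rewrite in_setU1 => /orP[/eqP->|dY]; first exact: kmax.
    apply: leq_trans ((mY r2).2 _ dY).
    have [v vP] := dominatingP _ dj l.
    have := vP _ (setU1r _ (mY v).1).
    have [->//|vr2] := eqVneq v r2.
    by have /forall_inP/(_ _ vr2) := lK; rewrite ltnNge => /negbTE->.
  move: lK; rewrite negb_forall => /existsP[v]; rewrite negb_imply -leqNgt.
  case/andP => vr2 lv; exists v => d; rewrite in_setU1 => /orP[/eqP->|dY].
    by apply: leq_trans lv _; apply/ltnW/kK.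
  by apply: leq_trans lv _; case: (mY v) => _; apply.
suff -> : F = [set j; k] by rewrite cards2 eq_sym kj.
apply/setP => l; rewrite !inE; apply/andP/orP => [[lY dl]|[]/eqP-> //].
have [r [lr injr Kl _]] := dominating_row mY cY lY dl.
have [rr1|rr1] := eqVneq r r1.
  by left; apply/eqP/(dominating_same_row mY dl dj (r := r1)) => //; rewrite -rr1.
have [rr2|rr2] := eqVneq r r2.
  by right; apply/eqP/(dominating_same_row mY dl dk (r := r2)) => //; rewrite -rr2.
by case/eqP: r2r1; apply: injr; rewrite ?inE // eq_sym.
Qed.

End DominatingSets.

(** * The parity argument *)

Section Parity.

Variables (V J : finType) (c : V -> J -> nat) (s : V -> J) (feas : pred {set J}).
Hypothesis c_inj : forall v, injective (c v).
Hypothesis s_inj : injective s.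
Hypothesis c_own : forall v j, c v (s v) <= c v j.
Hypothesis c_other : forall v u j, u != v -> j \notin codom s -> c v j < c v (s u).
Hypothesis feas_even : forall X : {set J}, #|X| = #|V|.+1 ->
  ~~ odd #|[set k in X | feas (X :\ k)]|.
Hypothesis feas_slack : feas (s @: setT).

(** Every row other than [i] has its own slack, its least column, in the set, so columns outside the
    set can be dominated only in row [i]. The unique completion is the largest column of row [i]
    outside the set. *)
Lemma dominating_slack_row (i : V) :
  #|[set j | (j \notin s @: [set~ i]) && dominating c (j |: s @: [set~ i])]| = 1.
Proof.
set Y := s @: [set~ i].
have iY : s i \notin Y.
  by apply/imsetP => -[u]; rewrite !inE => ui /s_inj iu; rewrite iu eqxx in ui.
have outY j : j \notin Y -> j = s i \/ j \notin codom s.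
  move=> jY; have [/codomP[u ju]|] := boolP (j \in codom s); last by right.
  left; rewrite ju; congr s; apply/eqP; apply: contraNT jY => ui.
  by rewrite ju; apply: imset_f; rewrite !inE.
have [j jY jmax] := arg_maxnP (P := fun j => j \notin Y) (c i) iY.
suff -> : [set j | (j \notin Y) && dominating c (j |: Y)] = [set j] by rewrite cards1.
apply/setP => k; rewrite !inE; apply/andP/eqP => [[kY /dominatingP/(_ j)[v vP]]|->].
  have vi : v = i.
    apply/eqP; apply: contraNT jY => vi.
    have svY : s v \in Y by apply: imset_f; rewrite !inE.
    suff <- : s v = j by [].
    apply: (@c_inj v); apply/eqP; rewrite eqn_leq c_own.
    by apply: vP; rewrite inE svY orbT.
  subst v; apply: (@c_inj i); apply/eqP; rewrite eqn_leq vP ?setU11 ?andbT //.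
  exact: jmax.
split=> //; apply/dominatingP => l.
have [/imsetP[u _ ->]|lY] := boolP (l \in Y); first by exists u => d _; apply: c_own.
exists i => d; rewrite in_setU1 => /orP[/eqP->|]; first exact: jmax.
case/imsetP => u; rewrite !inE => ui ->.
have [->|lS] := outY _ lY; first exact: c_own.
exact/ltnW/c_other.
Qed.

(* Count the pairs (Y, k) with k |: Y dominating and s i |: Y feasible in two ways. *)
Lemma feasible_dominating_exists (i : V) : exists2 B, feas B & dominating c B.
Proof.
apply: contrapT => no_B.
have noB B : feas B -> dominating c B = false.
  by move=> fB; apply/negP => dB; apply: no_B; exists B.
have sumE (P : pred J) (Q : pred J) :
    \sum_(k | P k) (Q k : nat) = #|[set k | P k && Q k]|.
  by rewrite cardsE -sum1_card big_mkcondr.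
pose T := \sum_(Y : {set J} | (s i \notin Y) && (#|Y|.+1 == #|V|))
  \sum_(k | (k \notin Y) && (k != s i)) (dominating c (k |: Y) && feas (s i |: Y) : nat).
(* Grouped by [Y]: the slacks other than [s i] have exactly one completion, and any other [Y]
   contains a column that is no slack, so [even_dominating] applies. Excluding [k = s i] loses
   nothing, since a feasible [s i |: Y] is not dominating. *)
have Todd : odd T.
  pose Y0 := s @: [set~ i].
  have iY0 : s i |: Y0 = s @: setT by rewrite -imsetU1 setUCr.
  have sY0 : s i \notin Y0.
    by apply/imsetP => -[u]; rewrite !inE => ui /s_inj iu; rewrite iu eqxx in ui.
  have cY0 : #|Y0|.+1 = #|V|.
    by have := cardsU1 (s i) Y0; rewrite sY0 iY0 card_imset // cardsT.
  have inner Y : feas (s i |: Y) ->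
      \sum_(k | (k \notin Y) && (k != s i))
        (dominating c (k |: Y) && true : nat) =
      #|[set k | (k \notin Y) && dominating c (k |: Y)]|.
    move=> fY; rewrite sumE; apply: eq_card => k; rewrite !inE andbT.
    have [->|] := eqVneq k (s i); last by rewrite andbT.
    by rewrite noB // !andbF.
  rewrite /T (bigD1 Y0) /=; last by rewrite sY0 cY0 eqxx.
  rewrite iY0 feas_slack inner ?iY0 // dominating_slack_row addSn.
  rewrite add0n oddS -dvdn2.
  apply: dvdn_sum => Y /andP[/andP[iY /eqP cY] YY0].
  have [fY|nfY] := boolP (feas (s i |: Y)); last first.
    by rewrite big1 // => k _; rewrite andbF.
  rewrite inner // dvdn2.
  have [e eY eS] : exists2 e, e \in Y & e \notin codom s.
    apply/exists_inP; rewrite -negb_forall_in; apply: contraNN YY0 => /forall_inP YS.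
    rewrite eqEcard -ltnS cY cY0 leqnn andbT; apply/subsetP => y yY.
    have /codomP[u yu] := YS _ yY; rewrite yu; apply: imset_f; rewrite !inE.
    by apply: contraNneq iY => <-; rewrite -yu.
  by apply: (even_dominating c_inj (s := s) eY) => // v r vr; rewrite c_other // eq_sym.
(* Grouped by [D = k |: Y]: the sets [s i |: D :\ k] are those obtained from [s i |: D] by removing
   an element other than [s i]. Removing [s i] itself leaves the dominating set [D], which is
   infeasible, so [feas_even] gives the parity. *)
suff : ~~ odd T by rewrite Todd.
have -> : T = \sum_(D : {set J} | (s i \notin D) && (#|D| == #|V|))
    \sum_(k in D) (dominating c (k |: D :\ k) && feas (s i |: D :\ k) : nat).
  rewrite /T !pair_big_dep /=.
  rewrite (reindex_onto (fun p : {set J} * J => (p.1 :\ p.2, p.2))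
                        (fun p => (p.2 |: p.1, p.2))) /=; last first.
    by case=> Y k /= /andP[_ /andP[kY _]]; rewrite setU1K.
  apply: eq_bigl => -[D k] /=; have [kD|kD] := boolP (k \in D); last first.
    rewrite andbF; apply/negP => /andP[_ /eqP[Dk]].
    by rewrite -Dk setU11 in kD.
  rewrite setD1K // eqxx !andbT !inE eqxx /= (cardsD1 k D) kD add1n.
  have [<-|ki] := eqVneq k (s i); last by rewrite andbT.
  by rewrite kD !andbF.
rewrite -dvdn2.
apply: dvdn_sum => D /andP[iD /eqP cD].
have [dD|ndD] := boolP (dominating c D); last first.
  by rewrite big1 // => k kD; rewrite setD1K // (negbTE ndD).
have fD : feas D = false by apply/negP => /noB; rewrite dD.
rewrite (eq_bigr (fun k => nat_of_bool (feas (s i |: D :\ k)))); last first.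
  by move=> k kD; rewrite setD1K // dD.
rewrite sumE dvdn2.
have := @feas_even (s i |: D); rewrite cardsU1 iD cD add1n => /(_ erefl).
congr (~~ odd _); apply: eq_card => k; rewrite !inE.
have [->|ki] /= := eqVneq k (s i); first by rewrite setU1K // fD (negbTE iD).
case kD: (k \in D) => //=; congr feas; apply/setP => l; rewrite !inE.
by have [->|] := eqVneq l k; rewrite ?(negbTE ki) // orbF.
Qed.

End Parity.

(** * Kernel vectors and feasible bases *)

Local Open Scope ring_scope.

Lemma dependent_columns (R : fieldType) (I V : finType) (D : {set I})
    (S : {set V}) (a : I -> V -> R) :
  (#|S| < #|D|)%N ->
  exists y : I -> R,
    [/\ exists2 i, i \in D & y i != 0,
        forall i, i \notin D -> y i = 0
      & forall v, v \in S -> \sum_i y i * a i v = 0].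
Proof.
move=> ltSD.
pose M : 'M[R]_(#|D|, #|S|) := \matrix_(i, j) a (enum_val i) (enum_val j).
have kerN0 : kermx M != 0.
  rewrite -mxrank_eq0 mxrank_ker subn_eq0 -ltnNge.
  exact: leq_ltn_trans (rank_leq_col M) ltSD.
have /rowV0Pn[u /sub_kermxP uM0 uN0] := kerN0.
have [k ukN0] : exists k, u 0 k != 0 by apply/rV0Pn.
(* Outside [D] the index is set to [#|D|], which is out of range, so that [insub] fails and the
   default 0 is taken. *)
pose y i := oapp (u 0) 0 (insub (if i \in D then index i (enum D) else #|D|)
  : option 'I_#|D|).
have yE (j : 'I_#|D|) : y (enum_val j) = u 0 j.
  rewrite /y enum_valP.
  have idx : index (enum_val j) (enum D) = j.
    by rewrite /enum_val index_uniq ?enum_uniq // -cardE.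
  by rewrite idx valK.
have y0 i : i \notin D -> y i = 0.
  by move=> /negbTE iD; rewrite /y iD insubN // ltnn.
exists y; split=> //.
  by exists (enum_val k); rewrite ?enum_valP // yE.
move=> v vS; rewrite (bigID (mem D)) /= [X in _ + X]big1 ?addr0; last first.
  by move=> i iD; rewrite y0 ?mul0r.
rewrite (reindex_omap (@enum_val _ (mem D))
  (fun i => if i \in D then Some (enum_rank_in (enum_valP k) i) else None)) /=;
  last first.
  by move=> i iD; rewrite iD /= enum_rankK_in.
have /matrixP/(_ 0 (enum_rank_in vS v)) := uM0.
rewrite !mxE => uMv; rewrite -[RHS]uMv; apply: eq_big => [j|j _].
  by rewrite enum_valP enum_valK_in eqxx.
by rewrite yE mxE [enum_val (enum_rank_in _ _)]enum_rankK_in.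
Qed.

(** The index [i0] minimises [x i / - y i] over the negative entries of [y], so this is the longest
    step that keeps all coordinates nonnegative. *)
Lemma ratio_test (R : realFieldType) (I : finType) (x y : I -> R) :
  (forall i, 0 <= x i) -> (exists i, y i < 0) ->
  exists2 i0, y i0 < 0 & forall i, 0 <= x i + x i0 / - y i0 * y i.
Proof.
move=> x0 [j yj].
case: (arg_minP (P := fun i => y i < 0) (fun i => x i / - y i) yj) => i0 yi0 imin.
exists i0 => // i; have [yi|yi] := ltP (y i) 0; last first.
  by rewrite addr_ge0 ?mulr_ge0 // invr_ge0; lra.
have := imin _ yi; rewrite ler_pdivlMr ?oppr_gt0 // => H.
by rewrite mulrN in H; lra.
Qed.

Section FeasibleBases.

Variables (R : realFieldType) (J V : finType) (a : J -> V -> R) (b : V -> R).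

Definition solution (z : J -> R) : Prop :=
  (forall j, 0 <= z j) /\ (forall v, \sum_j z j * a j v = b v).

Definition feasible (B : {set J}) : bool :=
  (#|B| == #|V|) && `[< exists2 z, solution z & forall j, j \notin B -> z j = 0 >].

Hypothesis a_ge0 : forall j v, 0 <= a j v.
Hypothesis a_gt0 : forall j, exists v, 0 < a j v.
Hypothesis nondegenerate :
  forall z, solution z -> (#|V| <= #|[set j | z j != 0%R]|)%N.

Lemma kernel_neg (y : J -> R) :
  (exists j, y j != 0) -> (forall v, \sum_j y j * a j v = 0) ->
  exists j, y j < 0.
Proof.
move=> [j yj] y0; have [//|yge0] := pselect (exists j, y j < 0).
have {}yge0 i : 0 <= y i by rewrite leNgt; apply/negP => yi; apply: yge0; exists i.
have [v av] := a_gt0 j.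
have /eqP := y0 v; rewrite psumr_eq0 => [/allP/(_ j)|i _]; last by rewrite mulr_ge0.
by rewrite mem_index_enum mulf_eq0 (negbTE yj) gt_eqF // => /(_ isT).
Qed.

Lemma move_along_kernel (z y : J -> R) : solution z ->
  (exists j, y j != 0) -> (forall v, \sum_j y j * a j v = 0) ->
  exists2 j, y j < 0 & solution (fun i => z i + z j / - y j * y i).
Proof.
move=> [z0 zb] yN0 y0; have [j yj jP] := ratio_test z0 (kernel_neg yN0 y0).
exists j => //; split=> // v; under eq_bigr => i _ do rewrite mulrDl -mulrA.
by rewrite big_split /= -mulr_sumr y0 mulr0 addr0.
Qed.

Lemma moved_eq0 (z y : J -> R) (j : J) : y j < 0 -> z j + z j / - y j * y j = 0.
Proof. by move=> yj; field; lra. Qed.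

Lemma feasibleP (B : {set J}) : feasible B ->
  #|B| = #|V| /\ exists2 z, solution z & forall j, (z j != 0) = (j \in B).
Proof.
case/andP => /eqP cB /asboolP[z zs zB]; split => //; exists z => //.
have sB : [set j | z j != 0] \subset B.
  by apply/subsetP => j; rewrite inE; apply: contraR => /zB ->.
have /eqP <- : [set j | z j != 0] == B by rewrite eqEcard sB cB nondegenerate.
by move=> j; rewrite inE.
Qed.

(** The columns of a feasible set are independent: moving along a nonzero kernel vector until a
    coordinate vanishes would give a solution with fewer than [#|V|] nonzero entries. *)
Lemma feasible_kernel (B : {set J}) (y : J -> R) : feasible B ->
  (forall j, j \notin B -> y j = 0) -> (forall v, \sum_j y j * a j v = 0) ->
  forall j, y j = 0.
Proof.
move=> /feasibleP[cB [z zs zB]] yB y0 j; apply/eqP/negPn/negP => yj.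
have [i yi /nondegenerate] := move_along_kernel zs (ex_intro _ j yj) y0.
apply/negP; rewrite -ltnNge -cB; apply: proper_card.
have iB : i \in B by apply: contraT => /yB yi0; move: yi; rewrite yi0 ltxx.
apply/properP; split; last by exists i; rewrite // inE moved_eq0 ?eqxx.
apply/subsetP => l; rewrite inE; apply: contraR => lB.
by rewrite (yB l) // mulr0 addr0; apply: contraNT lB; rewrite zB.
Qed.

(** The simplex pivot: up to scaling, [y] is the only kernel vector supported in [X], and the ratio
    test along it singles out the only element [l] besides [k] whose removal leaves a feasible
    set. *)
Lemma even_feasible (X : {set J}) : #|X| = #|V|.+1 ->
  ~~ odd #|[set k in X | feasible (X :\ k)]|.
Proof.
move=> cX; set F := [set _ in _ | _].
have [->|[k]] := set_0Vmem F; first by rewrite cards0.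
rewrite inE => /andP[kX fk].
have [y0 [[i iX y0i] y0X ker0]] :
    exists y : J -> R, [/\ exists2 i, i \in X & y i != 0,
      forall i, i \notin X -> y i = 0 & forall v, v \in [set: V] -> \sum_i y i * a i v = 0].
  by apply: dependent_columns; rewrite cX cardsT.
have y0k : y0 k != 0.
  apply/negP => /eqP y0k; move: y0i; rewrite (feasible_kernel fk) ?eqxx //.
    by move=> j; rewrite !inE negb_and negbK => /orP[/eqP->//|/y0X].
  by move=> v; apply: ker0; rewrite inE.
pose y j := y0 j / y0 k.
have yk : y k = 1 by rewrite /y divff.
have yX j : j \notin X -> y j = 0 by move=> jX; rewrite /y y0X ?mul0r.
have kery v : \sum_j y j * a j v = 0.
  under eq_bigr => j _ do rewrite /y mulrAC.
  by rewrite -mulr_suml ker0 ?inE // mul0r.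
have [cB [z zs zB]] := feasibleP fk.
have zk : z k = 0 by have := zB k; rewrite !inE eqxx => /negbFE/eqP.
have [|l yl ls] := move_along_kernel zs _ kery; first by exists k; rewrite yk oner_neq0.
have lk : l != k by apply/eqP => lk; rewrite lk yk ltr10 in yl.
have lX : l \in X by apply: contraT => /yX yl0; rewrite yl0 ltxx in yl.
set z1 := fun i => _ in ls.
have z1X j : j \notin X -> z1 j = 0.
  move=> jX; rewrite /z1 (yX j) // mulr0 addr0; have := zB j.
  by rewrite !inE (negbTE jX) andbF => /negbFE/eqP.
have z1l : z1 l = 0 by rewrite /z1 moved_eq0.
have fl : feasible (X :\ l).
  apply/andP; split; first by have := cardsD1 l X; rewrite lX cX add1n => -[->].
  apply/asboolP; exists z1 => // j; rewrite !inE negb_and negbK.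
  by case/orP => [/eqP->//|/z1X].
suff -> : F = [set k; l] by rewrite cards2 eq_sym lk.
apply/setP => m; rewrite !inE; apply/idP/idP; last first.
  by case/orP => /eqP->; apply/andP.
case/andP => mX fm; have [//|mk /=] := eqVneq m k.
have [_ [z2 [z2p z2s] z2B]] := feasibleP fm.
have z2m : z2 m = 0 by have := z2B m; rewrite !inE eqxx => /negbFE/eqP.
have z2k : 0 < z2 k.
  by rewrite lt_neqAle z2p eq_sym z2B !inE eq_sym mk kX.
(* The difference of the two sides is a kernel vector supported in the feasible set [X :\ k]. *)
have z2E j : z2 j = z j + z2 k * y j.
  suff /(_ j) : forall j, z2 j - z j - z2 k * y j = 0 by lra.
  apply: (feasible_kernel fk) => [i0|v].
    rewrite !inE negb_and negbK => /orP[/eqP->|i0X]; first by rewrite yk zk; lra.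
    have := z2B i0; rewrite !inE (negbTE i0X) andbF => /negbFE/eqP->.
    have := zB i0; rewrite !inE (negbTE i0X) andbF => /negbFE/eqP->.
    by rewrite yX // subrr mulr0 subr0.
  under eq_bigr => j0 _ do rewrite !mulrBl -mulrA.
  by rewrite !sumrB -mulr_sumr kery z2s zs.2; lra.
have [lz2] : z2 k <= z l / - y l.
  rewrite ler_pdivlMr ?oppr_gt0 //; have := z2p l; rewrite z2E; lra.
have ym : y m < 0.
  have zm : z m > 0.
    by rewrite lt_neqAle zs.1 eq_sym zB !inE mk mX.
  have : z2 k * y m < 0 by have := z2E m; rewrite z2m; lra.
  by rewrite pmulr_rlt0.
(* [z1] and [z2] lie on the same ray. As [l] vanishes at [z1] and [m] at [z2], while both stay
   nonnegative at both points, the step lengths agree. Thus [l] also vanishes at [z2], which forces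
   [l = m]. *)
have z2kE : z2 k = z l / - y l.
  apply/eqP; rewrite eq_le lz2; have := ls.1 m; have := z2E m; rewrite z2m /z1.
  move=> H1 H2; have : 0 <= (z l / - y l - z2 k) * y m by lra.
  by rewrite nmulr_lge0 // subr_le0.
have : l \notin X :\ m by rewrite -z2B negbK z2E z2kE; apply/eqP; exact: z1l.
by rewrite !inE lX andbT negbK eq_sym.
Qed.

End FeasibleBases.

(** * Nondegenerate right-hand sides *)

Lemma poly_nonroot_small (R : realFieldType) (p : {poly R}) (eps : R) :
  p != 0 -> 0 < eps -> exists t, [/\ 0 < t, t <= eps & p.[t] != 0].
Proof.
move=> p0 eps0; pose t k : R := eps / k.+1%:R.
have t0 k : 0 < t k by rewrite divr_gt0 // ltr0n.
have te k : t k <= eps by rewrite ler_pdivrMr ?ltr0n // ler_peMr ?ler1n // ltW.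
have t_inj : injective t.
  move=> k l /(mulfI (lt0r_neq0 eps0)) /invr_inj /eqP.
  by rewrite eqr_nat eqSS => /eqP.
have [/allP rt|/allPn[_ /mapP[k _ ->] pk]] :=
  boolP (all (root p) [seq t k | k <- iota 0 (size p)]); last by exists (t k).
have := max_poly_roots p0 (introT allP rt).
by rewrite map_inj_uniq ?iota_uniq // size_map size_iota ltnn => /(_ isT).
Qed.

(* The right-hand side runs along a curve leaving every proper subspace spanned by columns. *)
Lemma generic_rhs (R : realFieldType) (J V : finType) (a : J -> V -> R) (eps : R) :
  0 < eps ->
  exists2 b : V -> R, (forall v, 1 <= b v <= 1 + eps) &
    forall z : J -> R, (forall v, \sum_j z j * a j v = b v) ->
    (#|V| <= #|[set j | z j != 0%R]|)%N.
Proof.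
move=> eps0; pose curve (t : R) (v : V) := 1 + t ^+ (enum_rank v).+1.
(* One polynomial serves all small supports at once: it is a product with one factor for each [D]
   having fewer than [#|V|] columns. *)
suff [p p0 pP] : exists2 p : {poly R}, p != 0 &
    forall D : {set J}, D \in enum {set J} -> (#|D| < #|V|)%N ->
    forall t, p.[t] != 0 -> forall z : J -> R, (forall j, j \notin D -> z j = 0) ->
    ~ (forall v, \sum_j z j * a j v = curve t v).
  have [||t [t0 te pt]] := @poly_nonroot_small R p (Num.min eps 1);
    rewrite ?lt_min ?eps0 ?ltr01 //.
  move: te; rewrite le_min => /andP[te t1].
  exists (curve t) => [v|z zb].
    rewrite lerDl exprn_ge0 ?(ltW t0) //= lerD2l (le_trans _ te) //.
    by rewrite exprS ler_piMr ?(ltW t0) // exprn_ile1 // ltW.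
  rewrite leqNgt; apply/negP => ltzV.
  apply: (pP [set j | z j != 0%R] _ ltzV t pt z) => //; first by rewrite mem_enum.
  by move=> j; rewrite inE negbK => /eqP.
elim: (enum {set J}) => [|D s [p p0 pP]]; first by exists 1; rewrite ?oner_neq0.
have [leVD|ltDV] := leqP #|V| #|D|.
  exists p => // D'; rewrite in_cons => /orP[/eqP->|/pP//].
  by rewrite ltnNge leVD.
have [|y [[v0 _ yv0] _ y0]] :=
  @dependent_columns R V J [set: V] D (fun v j => a j v); first by rewrite cardsT.
(* The vector [y] is orthogonal to the columns in [D], and [q] is its pairing with the curve. It is
   not zero because distinct vertices use distinct positive exponents. *)
pose q : {poly R} := \sum_v y v *: (1 + 'X^((enum_rank v).+1)).
have qt t : q.[t] = \sum_v y v * curve t v.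
  by rewrite horner_sum; apply: eq_bigr => v _; rewrite !hornerE.
have q0 : q != 0.
  apply: contraNneq yv0 => /(congr1 (fun r : {poly R} => r`_(enum_rank v0).+1)).
  rewrite coef0 coef_sum (bigD1 v0) //= big1 => [|v vv0].
    by rewrite coefZ coefD coef1 coefXn eqxx /= add0r mulr1 addr0 => ->.
  rewrite coefZ coefD coef1 coefXn eqSS /= add0r.
  rewrite (_ : (_ == _) = false) ?mulr0 //; apply/negP => /eqP/val_inj/enum_rank_inj.
  by move=> /esym/eqP; rewrite (negbTE vv0).
exists (p * q) => [|D']; first by rewrite mulf_neq0.
rewrite in_cons => /orP[/eqP->|D's] cD' t; rewrite hornerM mulf_eq0 negb_or.
  case/andP => _ qt0 z zD zb; case/eqP: qt0; rewrite qt.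
  under eq_bigr => v _ do rewrite -zb mulr_sumr.
  rewrite exchange_big /= big1 // => j _; have [jD|jD] := boolP (j \in D); last first.
    by rewrite big1 // => v _; rewrite zD // mul0r mulr0.
  under eq_bigr => v _ do rewrite mulrCA.
  by rewrite -mulr_sumr y0 // mulr0.
by case/andP => pt _; apply: pP.
Qed.

(** * Slack columns and edge columns *)

Section Scarf.

Variables (R : realFieldType) (V E : finType) (inc : E -> V -> bool).
Variables (rk : V -> E -> nat) (b : V -> R).
Hypothesis inc_ex : forall e, exists v, inc e v.
Hypothesis rk_inj : forall v e f, inc e v -> inc f v -> rk v e = rk v f -> e = f.

Definition column (j : V + E) (v : V) : R :=
  match j with inl u => (u == v)%:R | inr e => (inc e v)%:R end.

(** In row [v] the slack of [v] comes first, then the edges at [v] by rank, then the other edges,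
    then the other slacks. [N] exceeds all shifted ranks, and [enum_rank] breaks ties. *)
Definition scarf_order (v : V) (j : V + E) : nat :=
  let N := (\max_e rk v e).+2 in
  match j with
  | inl u => if u == v then 0%N else (N + #|E| + enum_rank u)%N
  | inr e => if inc e v then (rk v e).+1 else (N + enum_rank e)%N
  end.

Lemma scarf_order_inj v : injective (scarf_order v).
Proof.
have rkN e : (rk v e <= \max_e rk v e)%N by apply: leq_bigmax.
have ne (u : V) (e : E) : (#|E| + enum_rank u)%N <> enum_rank e.
  by move=> H; have := ltn_ord (enum_rank e); rewrite -H ltnNge leq_addr.
move=> [u|e] [u'|f] /=.
- have [->|_] := eqVneq u v; have [->|_] := eqVneq u' v => // H; try by exfalso; lia.
  by congr inl; apply/enum_rank_inj/val_inj => /=; lia.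
- have := rkN f; have := ne u f; case: ifP => _; case: ifP => _ H ? H'; exfalso;
    try lia.
  by apply: H; move: H'; rewrite -addnA => /addnI.
- have := rkN e; have := ne u' e; case: ifP => _; case: ifP => _ H ? H'; exfalso;
    try lia.
  by apply: H; move: H'; rewrite -addnA => /addnI ->.
- have := rkN e; have := rkN f; case: ifP => ev; case: ifP => fv ? ? H;
    try by exfalso; lia.
    by case: H => H; congr inr; apply: rk_inj H.
  by congr inr; apply/enum_rank_inj/val_inj => /=; lia.
Qed.

Theorem scarf (v0 : V) : (forall v, 0 < b v) ->
  (forall z, solution column b z -> (#|V| <= #|[set j | z j != 0%R]|)%N) ->
  exists x : E -> R,
    [/\ forall e, 0 <= x e, forall v, \sum_(e | inc e v) x e <= b v
      & forall e, exists v, [/\ inc e v, \sum_(e | inc e v) x e = b v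
          & forall f, x f != 0 -> inc f v -> (rk v e <= rk v f)%N]].
Proof.
move=> b0 nondeg.
have col0 j v : 0 <= column j v by case: j => ?; apply: ler0n.
have colgt0 j : exists v, 0 < column j v.
  case: j => [u|e]; first by exists u; rewrite /= eqxx ltr01.
  by have [v ev] := inc_ex e; exists v; rewrite /= ev ltr01.
have sumE (z : V + E -> R) v :
    \sum_j z j * column j v = z (inl v) + \sum_(e | inc e v) z (inr e).
  rewrite big_sumType /= (bigD1 v) //= eqxx mulr1 big1 ?addr0 => [|u uv].
    by congr (_ + _); rewrite [RHS]big_mkcond; apply: eq_bigr => e _;
      case: (inc e v); rewrite ?mulr1 ?mulr0.
  by rewrite (negbTE uv) mulr0.
have [||||B fB /dominatingP dB] := feasible_dominating_exists (c := scarf_order)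
  (s := inl) (feas := feasible column b) scarf_order_inj _ _ _
  (even_feasible col0 colgt0 nondeg) _ v0.
- by move=> u u' [].
- by move=> v j /=; rewrite eqxx.
- move=> v u [u'|e] /= uv; first by rewrite codom_f.
  rewrite (negbTE uv) => _; have := @leq_bigmax _ (rk v) e.
  by case: ifP => _; [lia | rewrite -addnA ltn_add2l ltn_addr].
- apply/andP; rewrite card_imset ?cardsT //; last by move=> u u' [].
  split=> //; apply/asboolP; exists (fun j => if j is inl v then b v else 0).
    split=> [[v|e]//|v]; first exact: ltW.
    by rewrite sumE big1 ?addr0.
  by case=> // v /negP[]; apply: imset_f.
have [_ [z [z0 zb] zB]] := feasibleP nondeg fB.
exists (fun e => z (inr e)); split=> [e|v|e]; first exact: z0.
  by rewrite -zb sumE lerDr.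
have [v vP] := dB (inr e).
(* The slack of [v] is the least column of its row, so a basis dominating [e] in row [v] cannot
   contain it, and the constraint at [v] is tight. *)
have slack0 : z (inl v) = 0.
  apply/eqP/negPn; rewrite zB; apply/negP => /vP /=.
  by rewrite eqxx; case: ifP.
have sat : \sum_(e | inc e v) z (inr e) = b v by rewrite -zb sumE slack0 add0r.
(* Otherwise every edge at [v] would lie below [e] in row [v], so none would be in the basis, and
   the tight constraint would give [b v = 0]. *)
have ev : inc e v.
  apply/negPn/negP => /negbTE ev; have := b0 v; rewrite -sat big1 ?ltxx // => f fv.
  apply/eqP/negPn; rewrite zB; apply/negP => /vP /=; rewrite ev fv.
  by have := @leq_bigmax _ (rk v) f; lia.
exists v; split=> // f zf fv; have : inr f \in B by rewrite -zB.
by move/vP; rewrite /= ev fv ltnS.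
Qed.

End Scarf.

(** * Fractional packings *)

Section FractionalPackings.

Variables (R : realFieldType) (V : finType) (B : {set {set V}}).
Hypothesis B_down : forall X Y : {set V}, X \in B -> Y \subset X -> Y \in B.
Hypothesis B_card : forall X : {set V}, X \in B -> (#|X| <= 3)%N.

Implicit Types (S A C D X Y : {set V}) (x y : {set V} -> R).

Definition fractional S x : Prop :=
  [/\ forall X, 0 <= x X,
      forall X, x X != 0 -> [/\ X \in B, X \subset S & X != set0]
    & forall v, v \in S -> \sum_(X : {set V} | v \in X) x X = 1].

Definition weight x : R := \sum_X x X.

Definition supp x : {set {set V}} := [set X | x X != 0].

(** The push-forward of [x] under intersection with [A], with the mass on the empty set
    discarded. *)
Definition restrict A x Y : R :=
  if Y == set0 then 0 else \sum_(X : {set V} | X :&: A == Y) x X.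

Lemma restrict_fractional A x : (forall X, 0 <= x X) ->
  (forall X, x X != 0 -> X \in B) ->
  (forall v, v \in A -> \sum_(X : {set V} | v \in X) x X = 1) ->
  fractional A (restrict A x).
Proof.
move=> x0 xB x1; split=> [Y|Y|v vA].
- by rewrite /restrict; case: ifP => // _; apply: sumr_ge0.
- rewrite /restrict; case: (eqVneq Y set0) => [_|Y0]; first by rewrite eqxx.
  rewrite psumr_neq0 => [/hasP[X _ /andP[/eqP <- xX]]|//].
  have XB := xB X (lt0r_neq0 xX).
  by split; rewrite ?subsetIr //; apply: B_down XB (subsetIl _ _).
- rewrite -[RHS](x1 v vA).
  rewrite [RHS](partition_big (fun X => X :&: A) (fun Y => v \in Y)) /=; last first.
    by move=> X vX; rewrite inE vX.
  apply: eq_bigr => Y vY; rewrite /restrict.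
  case: (eqVneq Y set0) => [Y0|_]; first by rewrite Y0 inE in vY.
  apply: eq_bigl => X; case: eqP => [XY|]; rewrite ?andbF // andbT.
  by move: vY; rewrite -XY inE => /andP[].
Qed.

Lemma fractional_restrict S A x :
  fractional S x -> A \subset S -> fractional A (restrict A x).
Proof.
case=> x0 xB x1 /subsetP AS; apply: restrict_fractional => // [X /xB[]//|v /AS].
exact: x1.
Qed.

Lemma weight_restrict A x :
  weight (restrict A x) = \sum_(X : {set V} | X :&: A != set0) x X.
Proof.
rewrite /weight (bigD1 set0) //= {1}/restrict eqxx add0r.
rewrite [RHS](partition_big (fun X => X :&: A) (fun Y => Y != set0)) //=.
apply: eq_bigr => Y Y0; rewrite /restrict (negbTE Y0); apply: eq_bigl => X.
by case: eqP => [->|]; rewrite ?andbF // Y0.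
Qed.

Lemma weight_restrictD S D x : fractional S x ->
  weight (restrict (S :\: D) x) + x D <= weight x.
Proof.
case=> x0 _ _; rewrite weight_restrict addrC /weight [leRHS](bigD1 D) //= lerD2l.
rewrite big_mkcond [leRHS]big_mkcond; apply: ler_sum => X _.
have [->|XD] /= := eqVneq X D; last by case: ifP => _; rewrite ?lexx ?x0.
rewrite (_ : D :&: (S :\: D) = set0) ?eqxx //.
by apply/setP => v; rewrite !inE; case: (v \in D).
Qed.

Lemma weight_restrict_le A x : (forall X, 0 <= x X) -> weight (restrict A x) <= weight x.
Proof.
move=> x0; rewrite weight_restrict big_mkcond; apply: ler_sum => X _.
by case: ifP.
Qed.

Lemma sum_card S x : fractional S x ->
  \sum_(X : {set V}) #|X|%:R * x X = #|S|%:R.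
Proof.
case=> x0 xB x1; rewrite -[RHS]sumr_const.
rewrite [RHS](eq_bigr (fun v => \sum_(X : {set V} | v \in X) x X)); last first.
  by move=> v /x1 ->.
rewrite [RHS](exchange_big_dep predT) //=; apply: eq_bigr => X _.
have [->|xX] := eqVneq (x X) 0; first by rewrite mulr0 big1.
have [_ XS _] := xB X xX; rewrite mulr_natl -sumr_const; apply: eq_bigl => v.
by rewrite andb_idl // => /(subsetP XS).
Qed.

Lemma weight_ge S x (k : nat) : fractional S x ->
  (forall X, x X != 0 -> (#|X| <= k)%N) -> #|S|%:R <= k%:R * weight x.
Proof.
move=> fx xk; have [x0 _ _] := fx.
rewrite -(sum_card fx) /weight mulr_sumr; apply: ler_sum => X _.
have [->|xX] := eqVneq (x X) 0; first by rewrite !mulr0.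
by rewrite ler_wpM2r // ler_nat xk.
Qed.

Lemma card_le_weight S x : fractional S x -> #|S|%:R <= 3 * weight x.
Proof.
by move=> fx; apply: (weight_ge (k := 3) fx) => X; case: fx => _ xB _ /xB[/B_card].
Qed.

(* As long as the support is larger than S, move along a kernel vector. *)
Lemma fractional_sparse S x : fractional S x ->
  exists x', [/\ fractional S x', weight x' <= weight x & (#|supp x'| <= #|S|)%N].
Proof.
have [n] := ubnP #|supp x|; elim: n x => // n IHn x ltn fx.
have [|ltS] := leqP #|supp x| #|S|; first by exists x.
have [x0 xB x1] := fx.
have [y0 [[X0 X0x y0X0] y0out ker0]] :=
  dependent_columns (fun X v => (v \in X)%:R : R) ltS.
(* The sign of the kernel vector is chosen so that moving along it does not increase the weight;
   being nonzero, it then has a negative entry. *)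
have [y [yN0 yout ker ysum]] : exists y, [/\ exists X, y X != 0,
    forall X, X \notin supp x -> y X = 0,
    forall v, v \in S -> \sum_X y X * (v \in X)%:R = 0 & \sum_X y X <= 0].
  have [le0|gt0] := lerP (\sum_X y0 X) 0; first by exists y0; split=> //; exists X0.
  exists (fun X => - y0 X); split=> [|X /y0out->|v vS|].
  - by exists X0; rewrite oppr_eq0.
  - by rewrite oppr0.
  - by under eq_bigr do rewrite mulNr; rewrite sumrN ker0 ?oppr0.
  - by rewrite sumrN oppr_le0 ltW.
have [X yX] : exists X, y X < 0.
  apply/existsP; apply: contraT; rewrite negb_exists => /forallP yge.
  have yge0 X : 0 <= y X by rewrite leNgt.
  have [Y /negP[]] := yN0.
  have /eqP : \sum_X y X = 0 by apply/eqP; rewrite eq_le ysum sumr_ge0.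
  by rewrite psumr_eq0 // => /allP/(_ Y); rewrite mem_index_enum => /(_ isT).
have [Z yZ zP] := ratio_test x0 (ex_intro _ X yX).
set l := x Z / - y Z in zP; pose z Y := x Y + l * y Y.
have l0 : 0 <= l by rewrite /l divr_ge0 // oppr_ge0 ltW.
have zZ : z Z = 0 by rewrite /z /l; field; lra.
have zsupp Y : z Y != 0 -> x Y != 0.
  apply: contraNneq => xY; rewrite /z xY yout ?mulr0 ?addr0 //.
  by rewrite inE xY eqxx.
have fz : fractional S z.
  split=> // [Y /zsupp/xB//|v vS]; rewrite big_split /= x1 // -mulr_sumr.
  suff -> : \sum_(Y : {set V} | v \in Y) y Y = 0 by rewrite mulr0 addr0.
  rewrite -[RHS](ker v vS) big_mkcond; apply: eq_bigr => Y _.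
  by case: (v \in Y); rewrite ?mulr1 ?mulr0.
have wz : weight z <= weight x.
  by rewrite /weight big_split /= -mulr_sumr gerDl mulr_ge0_le0.
have [|x' [fx' wx' sx']] := IHn z _ fz; last first.
  by exists x'; split=> //; apply: le_trans wx' wz.
rewrite -ltnS (leq_trans _ ltn) // ltnS; apply: proper_card; apply/properP; split.
  by apply/subsetP => Y; rewrite !inE; apply: zsupp.
exists Z; rewrite !inE ?zZ ?eqxx //; apply: contraTneq yZ => xZ.
by rewrite yout ?ltxx // inE xZ eqxx.
Qed.

(* Moving weight from X to X :\ v until v is covered exactly once. *)
Lemma fractional_exact S x : (forall X, 0 <= x X) ->
  (forall X, x X != 0 -> X \in B) ->
  (forall v, v \in S -> 1 <= \sum_(X : {set V} | v \in X) x X) ->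
  exists2 x', fractional S x' & weight x' <= weight x.
Proof.
move=> x0 xB x1.
suff [z [z0 zB z1 wz]] : exists z, [/\ forall X, 0 <= z X, forall X, z X != 0 -> X \in B,
    forall v, v \in S -> \sum_(X : {set V} | v \in X) z X = 1 & weight z <= weight x].
  exists (restrict S z); first exact: restrict_fractional.
  exact: le_trans (weight_restrict_le _ z0) wz.
suff [z [z0 zB z1 z2 wz]] : exists z, [/\ forall X, 0 <= z X,
    forall X, z X != 0 -> X \in B,
    forall v, v \in S -> v \in enum S -> \sum_(X : {set V} | v \in X) z X = 1,
    forall v, v \in S -> 1 <= \sum_(X : {set V} | v \in X) z X & weight z <= weight x].
  by exists z; split=> // v vS; apply: z1; rewrite // mem_enum.
elim: (enum S) => [|v s [z [z0 zB z1 z2 wz]]]; first by exists x.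
have [vS|vS] := boolP (v \in S); last first.
  exists z; split=> // u uS; rewrite in_cons => /orP[/eqP uv|]; last exact: z1.
  by rewrite uv (negbTE vS) in uS.
have [c cE] : exists c, c = \sum_(X : {set V} | v \in X) z X by eexists.
have c1 : 1 <= c by rewrite cE z2.
have c0 : 0 < c by apply: lt_le_trans c1.
have ci0 : 0 <= c^-1 by rewrite invr_ge0 ltW.
have ci1 : 0 <= 1 - c^-1 by rewrite subr_ge0 invf_le1.
(* [c] is the amount by which [v] is covered, so keeping the fraction [1 / c] of each set through
   [v] covers it exactly once. *)
pose z' X := if v \in X then z X / c else z X + (1 - c^-1) * z (v |: X).
(* Pairing [X] with [v |: X] shows that sums over families insensitive to [v] are unchanged: the
   total weight and the cover of every other vertex. *)
have sumE (f : {set V} -> R) (Q : pred {set V}) : (forall X, Q (X :\ v) = Q X) ->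
    \sum_(X | Q X) f X = \sum_(X : {set V} | Q X && (v \notin X)) (f X + f (v |: X)).
  move=> QE; rewrite (bigID (fun X => v \in X)) /= addrC big_split /=; congr (_ + _).
  rewrite (reindex_onto (fun X => v |: X) (fun X => X :\ v)) /=; last first.
    by move=> X /andP[_ vX]; rewrite setD1K.
  apply: eq_bigl => X; rewrite setU11 andbT; have [vX|vX] := boolP (v \in X).
    rewrite andbF; apply/negP => /andP[_ /eqP H].
    by move: vX; rewrite -H !inE eqxx.
  by rewrite setU1K // eqxx !andbT -QE setU1K.
have pairE X : v \notin X -> z' X + z' (v |: X) = z X + z (v |: X).
  move=> vX; rewrite /z' setU11 (negbTE vX).
  by rewrite mulrBl mul1r -addrA [z (v |: X) / c]mulrC subrK.
have keep (Q : pred {set V}) : (forall X, Q (X :\ v) = Q X) ->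
    \sum_(X | Q X) z' X = \sum_(X | Q X) z X.
  move=> QE; rewrite (sumE z' Q QE) (sumE z Q QE).
  by apply: eq_bigr => X /andP[_ vX]; apply: pairE.
have covE u : u != v -> \sum_(X : {set V} | u \in X) z' X = \sum_(X : {set V} | u \in X) z X.
  by move=> uv; apply: (keep (fun X : {set V} => u \in X)) => X; rewrite !inE uv.
have covv : \sum_(X : {set V} | v \in X) z' X = 1.
  under eq_bigr => X vX do rewrite /z' vX.
  by rewrite -mulr_suml -cE divff // gt_eqF.
exists z'; split=> [X|X|u uS|u uS|].
- by rewrite /z'; case: ifP => _; rewrite ?mulr_ge0 ?addr_ge0 ?mulr_ge0.
- rewrite /z'; case: ifP => _; first by rewrite mulf_eq0 negb_or => /andP[/zB].
  have [->|/zB XB _] := eqVneq (z X) 0; last exact: XB.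
  rewrite add0r mulf_eq0 negb_or.
  by case/andP => _ /zB H; apply: B_down H (subsetUr _ _).
- rewrite in_cons; have [->//|uv /= us] := eqVneq u v.
  by rewrite covE // z1.
- by have [->|uv] := eqVneq u v; rewrite ?covv // covE // z2.
- apply: le_trans wz; rewrite /weight.
  by have -> : \sum_X z' X = \sum_X z X by apply: (keep predT).
Qed.

End FractionalPackings.

(** * The bound on optimal packings *)

Section ChargeArithmetic.

Variable R : realFieldType.

Lemma natr_cases (k n : nat) : k%:R <= n%:R :> R \/ n%:R + 1 <= k%:R :> R.
Proof. by rewrite natr1 !ler_nat; case: (leqP k n) => H; [left|right]. Qed.

Lemma natr_case0 (k : nat) : k%:R = 0 :> R \/ 1 <= k%:R :> R.
Proof. by case: k => [|k]; [left|right; rewrite ler1n]. Qed.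

(** [k1], [k2], [k3] count the support sets of sizes 1, 2, 3 at a vertex and [s1], [s2], [s3] are
    their total weights; the strict bounds come from [block_weight]. The case distinctions exploit
    that the counts are integers. *)
Lemma charge_arith (k1 k2 k3 : nat) (s1 s2 s3 : R) :
  0 <= s1 -> 0 <= s2 -> 0 <= s3 -> s1 + s2 + s3 = 1 ->
  k1 = 0%N /\ s1 = 0 \/ 6 * s1 < 5 * k1%:R ->
  k2 = 0%N /\ s2 = 0 \/ 6 * s2 < 4 * k2%:R ->
  k3 = 0%N /\ s3 = 0 \/ 6 * s3 < 3 * k3%:R ->
  6 <= 2 * k3%:R + 3 * k2%:R + 6 * k1%:R + 2 * s2 + 2 * s1.
Proof.
move=> s1_ge0 s2_ge0 s3_ge0 cover1 h1 h2 h3.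
have n1 := ler0n R k1; have n2 := ler0n R k2; have n3 := ler0n R k3.
case: h1 => [[_ e1]|g1]; last by case: (natr_case0 k1) => c1; lra.
case: h2 => [[_ e2]|g2].
  case: h3 => [[_ e3]|g3]; first by lra.
  by case: (natr_cases k3 2%N) => c3; lra.
case: (natr_case0 k2) => c0; first by lra.
case: (natr_cases k2 1%N) => c2; last by lra.
case: h3 => [[_ e3]|g3]; first by lra.
by case: (natr_case0 k3) => c3; [lra|]; case: (natr_cases k3 1%N) => c3'; lra.
Qed.

(** The critical case has two triples and one pair whose weight is just above 1/3; its charge tends
    to 2 * 2 + 3 + 2/3 = 23/3. *)
Lemma light_charge_arith (k1 k2 k3 : nat) (s1 s2 s3 : R) :
  0 <= s1 -> 0 <= s2 -> 0 <= s3 -> s1 + s2 + s3 = 1 ->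
  k1 = 0%N /\ s1 = 0 \/ 6 * s1 < 5 * k1%:R ->
  k2 = 0%N /\ s2 = 0 \/ 6 * s2 < 4 * k2%:R ->
  k3 = 0%N /\ s3 = 0 \/ 6 * s3 < 3 * k3%:R ->
  [\/ k3 = 0%N, k3 = 1%N /\ 3 * s3 <= 1 | (1 < k3)%N /\ 3 * s3 < k3%:R] ->
  23 <= 3 * (2 * k3%:R + 3 * k2%:R + 6 * k1%:R + 2 * s2 + 2 * s1).
Proof.
move=> s1_ge0 s2_ge0 s3_ge0 cover1 h1 h2 h3.
have n1 := ler0n R k1; have n2 := ler0n R k2; have n3 := ler0n R k3.
move=> light.
have {light} : k3%:R = 0 :> R \/ (k3%:R = 1 :> R /\ 3 * s3 <= 1) \/
    (2 <= k3%:R :> R /\ 3 * s3 < k3%:R).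
  case: light => [->|[-> ?]|[k3_gt1 ?]]; [by left|by right; left|right; right].
  by rewrite (ler_nat _ 2).
move=> light; have z3 : k3%:R = 0 :> R -> s3 = 0 by case: h3 => [[]//|]; lra.
case: h1 => [[k10 e1]|g1].
  rewrite k10 e1; case: h2 => [[k20 e2]|g2].
    rewrite k20 e2; case: light => [/z3|[[]|[_ l3]]]; try lra.
    by case: (natr_cases k3 3%N) => c3; lra.
  case: (natr_case0 k2) => c0; first by lra.
  case: (natr_cases k2 2%N) => c2; last by lra.
  case: (natr_cases k2 1%N) => c1; last first.
    case: light => [k30|[[k31 l3]|[c3 l3]]]; [|lra..].
    by have := z3 k30; lra.
  case: light => [k30|[[k31 l3]|[c3 l3]]]; [|lra|].
    by have := z3 k30; lra.
  by case: (natr_cases k3 2%N) => c3'; lra.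
case: (natr_case0 k1) => c0; first by lra.
case: (natr_cases k1 1%N) => c1; last by lra.
case: light => [k30|[[k31 l3]|[c3 l3]]]; [|lra..].
have := z3 k30; case: h2 => [[_ e2]|g2]; first by lra.
by case: (natr_case0 k2) => c2; lra.
Qed.

End ChargeArithmetic.

Section WeightSeparated.

Variables (R : realFieldType) (V : finType) (B : {set {set V}}).
Hypothesis B_down : forall X Y : {set V}, X \in B -> Y \subset X -> Y \in B.

Lemma weight_separated (S A C : {set V}) (x : {set V} -> R) : fractional B S x ->
  separated B A C ->
  weight (restrict A x) + weight (restrict C x) <= weight (restrict (A :|: C) x).
Proof.
move=> [x0 xB _] /separatedP sAC; rewrite !weight_restrict.
rewrite big_mkcond [X in _ + X]big_mkcond -big_split [leRHS]big_mkcond /=.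
apply: ler_sum => X _; rewrite setIUr setU_eq0 negb_and.
have [XA|XA] /= := eqVneq (X :&: A) set0; have [XC|XC] /= := eqVneq (X :&: C) set0;
  rewrite ?addr0 ?add0r //.
have [->|xX] := eqVneq (x X) 0; first by rewrite addr0.
have [XB _ _] := xB X xX.
have [u /setIP[uX uA]] := set0Pn _ XA; have [v /setIP[vX vC]] := set0Pn _ XC.
have /negP[] := sAC u v uA vC; apply: B_down XB _.
by apply/subsetP => w; rewrite !inE => /orP[]/eqP->.
Qed.

End WeightSeparated.

(** * First properties of a minimal counterexample *)

Section MinimalCounterexample.

Variables (R : realFieldType) (V : finType) (B : {set {set V}}).
Hypothesis B_down : forall X Y : {set V}, X \in B -> Y \subset X -> Y \in B.
Hypothesis B_single : forall v, [set v] \in B.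
Hypothesis B_card : forall X : {set V}, X \in B -> (#|X| <= 3)%N.

Variables (S : {set V}) (x : {set V} -> R).
Hypothesis fx : fractional B S x.
Hypothesis sparse : (#|supp x| <= #|S|)%N.
Hypothesis minimal : forall (A : {set V}) (y : {set V} -> R), A \proper S ->
  fractional B A y -> 6 * (tau B A)%:R <= #|A|%:R + 6 * weight y.
Hypothesis counter : #|S|%:R + 6 * weight x < 6 * (tau B S)%:R.

Implicit Types (A C D X Y L t : {set V}) (u v : V).

Local Notation tau := (tau B).
Local Notation lobes := (lobes B).

Let x_ge0 X : 0 <= x X. Proof. by case: fx. Qed.
Let x_block X : x X != 0 -> X \in B. Proof. by case: fx => _ H _ /H[]. Qed.
Let x_sub X : x X != 0 -> X \subset S. Proof. by case: fx => _ H _ /H[]. Qed.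
Let x_neq0 X : x X != 0 -> X != set0. Proof. by case: fx => _ H _ /H[]. Qed.

Lemma minimal_restrict A : A \proper S ->
  6 * (tau A)%:R <= #|A|%:R + 6 * weight (restrict A x).
Proof.
by move=> AS; apply/(minimal AS)/(fractional_restrict B_down fx)/proper_sub.
Qed.

(** Adding [X] back to [S :\: X] raises [tau] by at most 1, the cardinality by [#|X|] and the weight
    by at least [x X]; a large [x X] would carry the bound from [S :\: X] to [S]. *)
Lemma block_weight X : x X != 0 -> 6 * x X < 6 - #|X|%:R.
Proof.
move=> xX; have XS := x_sub xX; have XB := x_block xX.
have pX : S :\: X \proper S.
  have [v vX] := set0Pn _ (x_neq0 xX); apply/properP; split; first exact: subsetDl.
  by exists v; rewrite ?(subsetP XS) // inE vX.
have := minimal_restrict pX; have := weight_restrictD X fx.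
have := tau_block B_down B_single S XB; rewrite -(ler_nat R) -natr1.
have := cardsID X S; have /setIidPr -> := XS; move/(congr1 (@GRing.natmul R 1)).
by rewrite natrD => *; have := counter; lra.
Qed.

Lemma inessential u : u \in S -> (tau (S :\ u) < tau S)%N.
Proof.
move=> uS; rewrite ltnNge -(ler_nat R); apply/negP => le.
have := minimal_restrict (properD1 uS); have := weight_restrict_le (S :\ u) x_ge0.
have := cardsD1 u S; rewrite uS add1n => /(congr1 (@GRing.natmul R 1)).
by rewrite -natr1 => *; have := counter; lra.
Qed.

(** Otherwise the bounds for the two proper parts add up to the bound for [S], as [tau] is
    subadditive and the weight is superadditive over separated sets. *)
Lemma no_split C : C \subset S -> C != set0 -> separated B C (S :\: C) -> C = S.
Proof.
move=> CS C0 sC; apply/eqP; rewrite eqEproper CS /=; apply/negP => pC.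
have pD : S :\: C \proper S.
  have [v vC] := set0Pn _ C0; apply/properP; split; first exact: subsetDl.
  by exists v; rewrite ?(subsetP CS) // inE vC.
have CU : C :|: (S :\: C) = S by rewrite setDE setUIr setUCr setIT; apply/setUidPr.
have := minimal_restrict pC; have := minimal_restrict pD.
have := weight_separated B_down fx sC; rewrite CU.
have := weight_restrict_le S x_ge0.
have := tauU B_down B_single C (S :\: C); rewrite CU -(ler_nat R) natrD.
have := cardsID C S; have /setIidPr -> := CS; move/(congr1 (@GRing.natmul R 1)).
by rewrite natrD => *; have := counter; lra.
Qed.

Lemma S_connected : connected B S.
Proof.
move=> u v uS vS; have [C CS uC] := component_cover B uS.
have CE : C = S.
  apply: no_split (component_separated CS); first exact: component_sub CS.
  by apply/set0Pn; exists u.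
by move: (component_connected CS); rewrite CE; apply.
Qed.

(** The upper bound is [gallai]; the lower one holds because [#|S| <= 3 * weight x] turns [counter]
    into [#|S| < 2 * tau S]. *)
Lemma tauS : (2 * tau S = #|S|.+1)%N.
Proof.
apply/eqP; rewrite eqn_leq (gallai B_down B_single S_connected inessential) /=.
rewrite ltnNge -(ler_nat R) natrM; apply/negP => le.
by have := card_le_weight B_card fx; have := counter; lra.
Qed.

Lemma weight_lt : 6 * weight x < 2 * #|S|%:R + 3.
Proof.
have := tauS => /(congr1 (@GRing.natmul R 1)); rewrite natrM -natr1.
by have := counter; lra.
Qed.

Definition heavy t := (#|t| == 3%N) && (1 <= 3 * x t).

(** * Lobes of a heavy triple *)

Section Heavy.

Variable t : {set V}.
Hypothesis ht : heavy t.

Let xt : 1 <= 3 * x t. Proof. by case/andP: ht. Qed.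
Let ct : #|t| = 3%N. Proof. by case/andP: ht => /eqP. Qed.
Let xt0 : x t != 0. Proof. by apply/eqP => H; have := xt; rewrite H; lra. Qed.

Lemma heavy_block : t \in B. Proof. exact: x_block. Qed.
Lemma heavy_sub : t \subset S. Proof. exact: x_sub. Qed.

Let A := S :\: t.

Let cA : #|S| = (#|A| + 3)%N.
Proof. by have := cardsID t S; have /setIidPr -> := heavy_sub; rewrite ct addnC. Qed.

Let pA : A \proper S.
Proof.
rewrite properE subsetDl; apply/negP => /subset_leq_card.
by rewrite cA leqNgt -addn1 leq_add2l.
Qed.

(** [weight_lt] reads [2 * #|A| + 9] in terms of [A], and dropping [t] saves [6 * x t >= 2]. *)
Lemma heavy_weight : 6 * weight (restrict A x) < 2 * #|A|%:R + 7.
Proof.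
have := weight_restrictD t fx; have := weight_lt; rewrite cA natrD -/A.
have := xt; lra.
Qed.

Lemma heavy_tau : (#|A|.+2 <= 2 * tau A)%N.
Proof.
have := tau_block B_down B_single S heavy_block; have := tauS.
by rewrite cA -/A; lia.
Qed.

(** Otherwise [6 * tau A] would be below [(#|A| - 1) + (2 * #|A| + 7)], that is [3 * #|A| + 6],
    against [heavy_tau]. *)
Lemma heavy_inessential : {in A, forall u, (tau (A :\ u) < tau A)%N}.
Proof.
move=> u uA; rewrite ltnNge -(ler_nat R); apply/negP => le.
have pu : A :\ u \proper S by apply: proper_trans pA; apply: properD1.
have := minimal_restrict pu.
have : weight (restrict (A :\ u) x) <= weight (restrict A x).
  rewrite !weight_restrict big_mkcond [leRHS]big_mkcond; apply: ler_sum => X _.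
  case: ifP => [XAu|_]; last by case: ifP.
  rewrite ifT //; have [v] := set0Pn _ XAu; rewrite !inE => /and4P[vX _ vt vS].
  by apply/set0Pn; exists v; rewrite !inE vX vt.
have := heavy_weight; have := heavy_tau; rewrite -(ler_nat R) natrM -!natr1.
have := cardsD1 u A; rewrite uA add1n => /(congr1 (@GRing.natmul R 1)); rewrite -natr1.
by move=> *; lra.
Qed.

Lemma heavy_two_lobes : (1 < #|lobes A|)%N.
Proof. exact: (two_lobes B_down B_single heavy_inessential heavy_tau). Qed.

Lemma lobeP C : C \in lobes A ->
  [/\ C \in components B A, (2 * tau C = #|C|.+1)%N & C \subset A].
Proof. by rewrite inE => /andP[CA /eqP]; split=> //; apply: component_sub CA. Qed.

Lemma lobe_weight C : C \in lobes A -> 2 * #|C|%:R + 3 <= 6 * weight (restrict C x).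
Proof.
case/lobeP => _ + CA; move/(congr1 (@GRing.natmul R 1)); rewrite natrM -natr1.
by have := minimal_restrict (sub_proper_trans CA pA); lra.
Qed.

Lemma weight_components C D : C \in components B A -> D \subset A -> [disjoint C & D] ->
  weight (restrict C x) + weight (restrict D x) <= weight (restrict (C :|: D) x).
Proof.
move=> CA DA CD; apply: (weight_separated B_down fx); apply/separatedP => u v uC vD.
have /separatedP := component_separated CA; apply=> //; rewrite inE (subsetP DA v vD) andbT.
by apply/negP => vC; have /pred0P/(_ v) := CD; rewrite /= vC vD.
Qed.

Lemma rest_weight D : D \subset A -> 2 * #|D|%:R <= 6 * weight (restrict D x).
Proof.
move=> DA; have := card_le_weight B_card (fractional_restrict B_down fx
  (subset_trans DA (proper_sub pA))); lra.
Qed.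

Lemma component_disjoint C D : C \in components B A -> D \in components B A ->
  C != D -> [disjoint C & D].
Proof.
move=> CA DA; apply: contraNT => /pred0Pn[v /andP[vC vD]].
by rewrite (components_uniq CA DA vC vD).
Qed.

Lemma weight_two_lobes C D : C \in lobes A -> D \in lobes A -> C != D ->
  6 * weight (restrict C x) + 6 * weight (restrict D x) +
    6 * weight (restrict (A :\: (C :|: D)) x) < 2 * #|A|%:R + 7.
Proof.
move=> /lobeP[CA _ CsA] /lobeP[DA _ DsA] CD; apply: le_lt_trans heavy_weight.
set Z := A :\: _; have ZA : Z \subset A by apply: subsetDl.
have dDZ : [disjoint D & Z].
  by apply/pred0P => v /=; rewrite !inE; case: (v \in D); rewrite ?orbT ?andbF.
have DZA : D :|: Z \subset A by rewrite subUset DsA.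
have dCDZ : [disjoint C & D :|: Z].
  have /pred0P dCD := component_disjoint CA DA CD.
  by apply/pred0P => v; have := dCD v; rewrite /= !inE; case: (v \in C) => //= ->.
have AE : C :|: (D :|: Z) = A.
  apply/setP => v; rewrite !inE; have [/(subsetP CsA)|_] := boolP (v \in C).
    by rewrite inE => ->.
  by have [/(subsetP DsA)|_] := boolP (v \in D); first by rewrite inE => ->.
have := weight_components CA DZA dCDZ; have := weight_components DA ZA dDZ.
by rewrite AE; lra.
Qed.

Lemma card_two_lobes C D : C \in lobes A -> D \in lobes A -> C != D ->
  #|A|%:R = #|C|%:R + #|D|%:R + #|A :\: (C :|: D)|%:R :> R.
Proof.
move=> /lobeP[CA _ CsA] /lobeP[DA _ DsA] CD; rewrite -!natrD; congr _%:R.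
have := cardsID (C :|: D) A; have /setIidPr -> : C :|: D \subset A by rewrite subUset CsA.
by move=> <-; congr addn; apply/eqP; rewrite (leq_card_setU C D) component_disjoint.
Qed.

(** Six times the weight is at least twice the cardinality on any part and exceeds this by 3 on a
    lobe. Three lobes would give [2 * #|A| + 9], too much for [heavy_weight]. *)
Lemma no_third_lobe C D L : C \in lobes A -> D \in lobes A -> C != D ->
  L \in lobes A -> L = C \/ L = D.
Proof.
move=> lC lD CD lL; have [LC|LC] := eqVneq L C; first by left.
have [LD|LD] := eqVneq L D; first by right.
have [CA _ CsA] := lobeP lC; have [DA _ DsA] := lobeP lD; have [LA _ LsA] := lobeP lL.
have := weight_two_lobes lC lD CD; have := card_two_lobes lC lD CD.
have := lobe_weight lC; have := lobe_weight lD; have := lobe_weight lL.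
set Z := A :\: _; have LZ : L \subset Z.
  apply/subsetP => v vL; rewrite inE (subsetP LsA v vL) andbT inE; apply/negP.
  case/orP => [vC|vD].
    by case/eqP: LC; apply: (components_uniq LA CA vL vC).
  by case/eqP: LD; apply: (components_uniq LA DA vL vD).
have ZA : Z \subset A by apply: subsetDl.
have ZLA : Z :\: L \subset A by apply: subset_trans ZA; apply: subsetDl.
have dL : [disjoint L & Z :\: L].
  by apply/pred0P => v /=; rewrite !inE; case: (v \in L).
have ZE : L :|: (Z :\: L) = Z by rewrite setDE setUIr setUCr setIT; apply/setUidPr.
have := weight_components LA ZLA dL; rewrite ZE; have := rest_weight ZLA.
have := cardsID L Z; have /setIidPr -> := LZ; move/(congr1 (@GRing.natmul R 1)).
by rewrite natrD => *; exfalso; clear LC LD CD ZE; lra.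
Qed.

(** The size of a lobe is odd. A lobe of size 1 has weight at least 1, an excess of 4 over twice its
    size; with the excess 3 of another lobe this reaches the forbidden [2 * #|A| + 7]. *)
Lemma lobe_card C : C \in lobes A -> (2 < #|C|)%N.
Proof.
move=> lC; have [D lD CD] : exists2 D, D \in lobes A & C != D.
  have /card_gt1P[D [D' [lD lD' DD']]] := heavy_two_lobes.
  by have [CD|] := eqVneq C D; [exists D'; rewrite ?CD | exists D].
have [CA tC CsA] := lobeP lC; have [_ _ DsA] := lobeP lD.
have C1 : #|C| != 1%N.
  apply/negP => /cards1P[v Cv].
  have := weight_two_lobes lC lD CD; have := card_two_lobes lC lD CD.
  have := lobe_weight lD; set Z := A :\: _.
  have ZA : Z \subset A by apply: subsetDl.
  have := rest_weight ZA; suff : 1 <= weight (restrict C x).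
    by rewrite Cv cards1; lra.
  rewrite weight_restrict; case: fx => _ _ /(_ v) x1.
  rewrite -[leLHS]x1; last first.
    by apply/(subsetP (proper_sub pA))/(subsetP CsA); rewrite Cv set11.
  rewrite big_mkcond [leRHS]big_mkcond; apply: ler_sum => X _.
  case: ifP => [vX|_]; last by case: ifP.
  by rewrite ifT //; apply/set0Pn; exists v; rewrite inE vX Cv set11.
have oC : odd #|C| by rewrite -[odd _]negbK -oddS -tC mul2n odd_double.
by move: oC C1; case: #|C| => [|[|[|n]]].
Qed.

(** Otherwise [C] is joined to the rest of [S] at most through [u]. Without such a link [no_split]
    is violated; with one, [u] can be absorbed into [C] at no cost, contradicting [inessential]. *)
Lemma lobe_neighbour C u : C \in lobes A ->
  exists y z, [/\ y \in t, y != u, z \in C & [set z; y] \in B].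
Proof.
move=> lC; have [CA tC CsA] := lobeP lC.
have [/exists_inP[y yt /andP[yu /exists_inP[z zC zy]]]|none] :=
  boolP [exists y in t, (y != u) && [exists z in C, [set z; y] \in B]].
  by exists y, z.
have CS : C \subset S by apply: subset_trans CsA (subsetDl _ _).
have sepC v w : v \in C -> w \in S -> w \notin C -> w != u -> [set v; w] \notin B.
  move=> vC wS wC wu; have [wt|wt] := boolP (w \in t).
    apply: contraNN none => vw; apply/exists_inP; exists w => //; rewrite wu /=.
    by apply/exists_inP; exists v.
  by have /separatedP := component_separated CA; apply; rewrite // !inE wC wt.
have uC : u \notin C -> u \in S.
  move=> uC; apply: contraT => uS.
  suff CE : C = S.
    by have := leq_ltn_trans (subset_leq_card CsA) (proper_card pA); rewrite CE ltnn.
  apply: (no_split CS); first by have [v vC] := component_neq0 CA; apply/set0Pn; exists v.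
  apply/separatedP => v w vC /setDP[wS wC]; apply: sepC => //.
  by apply: contraNneq uS => <-.
exfalso; set D := S :\: C :\ u.
have sCD : separated B C D.
  by apply/separatedP => v w vC; rewrite !inE => /and3P[wu wC wS]; apply: sepC.
have [uinC|{}uC'] := boolP (u \in C).
  suff CE : C = S.
    by have := leq_ltn_trans (subset_leq_card CsA) (proper_card pA); rewrite CE ltnn.
  apply: (no_split CS); first by apply/set0Pn; exists u.
  apply/separatedP => v w vC /setDP[wS wC]; apply: sepC => //.
  by apply: contraNneq wC => ->.
have uS := uC uC'.
have SuE : S :\ u = C :|: D.
  apply/setP => v; rewrite !inE; have [->|vu] /= := eqVneq v u; first by rewrite (negbTE uC').
  by have [/(subsetP CS)->|] := boolP (v \in C).
have SE : S = (u |: C) :|: D by rewrite -setUA -SuE setD1K.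
have := inessential uS; rewrite SuE.
have := tau_separated B_down B_single sCD.
have := tauU B_down B_single (u |: C) D; rewrite -SE.
suff le : (tau (u |: C) <= tau C)%N.
  move=> h1 h2; apply/negP; rewrite -leqNgt; apply: leq_trans h1 (leq_trans _ h2).
  by rewrite leq_add2r.
(* The pair of [u] and a neighbour [z] in [C] is one block, and deleting [z] lowers [tau C]. *)
have [/exists_inP[z zC zu]|nou] := boolP [exists z in C, [set z; u] \in B].
  have := tau_block B_down B_single (u |: C) zu.
  have -> : (u |: C) :\: [set z; u] = C :\ z.
    apply/setP => v; rewrite !inE; have [->|_] := eqVneq v u.
      by rewrite (negbTE uC') orbT andbF.
    by rewrite orbF.
  move=> /leq_trans; apply.
  exact: (component_inessential B_down B_single heavy_inessential CA zC).
suff CE : C = S by rewrite CE uS in uC'.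
apply: (no_split CS); first by have [v vC] := component_neq0 CA; apply/set0Pn; exists v.
apply/separatedP => v w vC /setDP[wS wC]; have [->|wu] := eqVneq w u; last exact: sepC.
by apply: contraNN nou => vu; apply/exists_inP; exists v.
Qed.

End Heavy.

(** * Leaves and light vertices *)

Lemma block_adjacent X u v : X \in B -> u \in X -> v \in X -> [set u; v] \in B.
Proof.
move=> XB uX vX; apply: B_down XB _.
by apply/subsetP => w; rewrite !inE => /orP[]/eqP->.
Qed.

(* C2 together with t :\: t' is connected in S :\: t', so a lobe of t' avoiding it
   is confined to C. *)
Lemma sublobe t t' C C2 y z : heavy t -> heavy t' ->
  C \in lobes (S :\: t) -> C2 \in lobes (S :\: t) -> C != C2 ->
  t' :&: C != set0 -> y \in t -> y \notin t' -> z \in C2 -> [set z; y] \in B ->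
  exists2 L, L \in lobes (S :\: t') & L \proper C.
Proof.
move=> ht ht' lC lC2 CC2 /set0Pn[q /setIP[qt' qC]] yt yt' zC2 zy.
have [CA tC CsA] := lobeP lC; have [C2A tC2 C2sA] := lobeP lC2.
have tB := heavy_block ht; have t'B := heavy_block ht'.
have t'S := heavy_sub ht'.
(* The block [t'] meets the component [C], so outside [t] it stays in [C] and thus avoids [C2]. *)
have t'sub v : v \in t' -> v \notin t -> v \in C.
  move=> vt' vt; apply: (component_closed CA qC); last exact: block_adjacent t'B qt' vt'.
  by rewrite inE vt (subsetP t'S).
have disjC v : v \in C -> v \notin C2.
  move=> vC; apply: contraNN CC2 => vC2; apply/eqP.
  exact: (components_uniq CA C2A vC vC2).
pose W := C2 :|: (t :\: t').
have WA : W \subset S :\: t'.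
  apply/subsetP => v; rewrite in_setU => /orP[vC2|/setDP[vt vt']].
    have := subsetP C2sA v vC2; rewrite !inE => /andP[vt ->]; rewrite andbT.
    by apply/negP => vt'; have := disjC v (t'sub v vt' vt); rewrite vC2.
  by rewrite inE vt' (subsetP (heavy_sub ht)).
have yW : y \in W by rewrite !inE yt yt' orbT.
have toy v : v \in W -> connect (adj B W) v y.
  rewrite {1}/W in_setU => /orP[vC2|/setDP[vt vt']].
    apply: connect_trans (_ : connect (adj B W) v z) _; last first.
      by apply: connect1; rewrite /adj /= yW zy !inE zC2.
    apply: connect_sub (component_connected C2A vC2 zC2) => a b /and3P[aC bC ab].
    by apply: connect1; rewrite /adj /= ab !inE aC bC.
  apply: connect1; rewrite /adj /= yW (block_adjacent tB vt yt).
  by rewrite !inE vt vt' orbT.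
have Wconn : connected B W.
  move=> u v uW vW; apply: connect_trans (toy u uW) _.
  by rewrite connect_adj_sym toy.
have [L lL yL] : exists2 L, L \in lobes (S :\: t') & y \notin L.
  have /card_gt1P[L1 [L2 [lL1 lL2 L12]]] := heavy_two_lobes ht'.
  have [yL1|yL1] := boolP (y \in L1); last by exists L1.
  exists L2 => //; apply: contraNN L12 => yL2; apply/eqP.
  have [LA1 _ _] := lobeP lL1; have [LA2 _ _] := lobeP lL2.
  exact: (components_uniq LA1 LA2 yL1 yL2).
exists L => //; have [LA tL LsA] := lobeP lL.
have LW v : v \in L -> v \notin W.
  move=> vL; apply: contraNN yL => vW.
  exact: (subsetP (connected_in_component LA WA Wconn vW vL)).
have LsubA : L \subset S :\: t.
  apply/subsetP => v vL; have := LW v vL; have := subsetP LsA v vL.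
  by rewrite !inE => /andP[-> ->]; case: (v \in t); rewrite ?orbT.
(* [L] avoids [W], so it lies in one component [D] of [S :\: t]. If [D] is [C], the vertex [q] makes
   the inclusion proper. Otherwise [D] avoids [t'], so [D = L] is a lobe of [t], hence [C2], which
   lies in [W]. *)
have [l lLl] := component_neq0 LA.
have [D DA lD] := component_cover B (subsetP LsubA l lLl).
have LD : L \subset D.
  exact: connected_in_component DA LsubA (component_connected LA) lLl lD.
have [DC|DC] := eqVneq D C.
  apply/properP; rewrite -DC; split=> //; exists q; first by rewrite DC.
  by apply/negP => /(subsetP LsA); rewrite inE qt'.
have DsA : D \subset S :\: t'.
  apply/subsetP => v vD; have := subsetP (component_sub DA) v vD.
  rewrite !inE => /andP[vt ->]; rewrite andbT; apply/negP => vt'.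
  by case/eqP: DC; exact: (components_uniq DA CA vD (t'sub v vt' vt)).
have DL : D = L.
  apply/eqP; rewrite eqEsubset LD andbT.
  exact: connected_in_component LA DsA (component_connected DA) lD lLl.
have lD' : D \in lobes (S :\: t) by rewrite inE DA DL tL eqxx.
case: (no_third_lobe ht lC lC2 CC2 lD') => [/eqP|DC2]; first by rewrite (negbTE DC).
by have := LW l lLl; rewrite inE -DC2 lD.
Qed.

Definition leaf t C := heavy t /\ C \in lobes (S :\: t) /\
  forall t' L, heavy t' -> L \in lobes (S :\: t') -> ~~ (L \proper C).

Lemma leaf_exists t C : heavy t -> C \in lobes (S :\: t) ->
  exists t1 C1, leaf t1 C1 /\ C1 \subset C.
Proof.
move=> ht lC; pose P (p : {set V} * {set V}) :=
  [&& heavy p.1, p.2 \in lobes (S :\: p.1) & p.2 \subset C].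
have P0 : P (t, C) by rewrite /P ht lC /=.
have [[t1 C1] /and3P[/= ht1 lC1 C1C] pmin] :=
  arg_minnP (fun p : {set V} * {set V} => #|p.2|) P0.
exists t1, C1; split=> //; split=> //; split=> // t' L ht' lL; apply/negP => LC1.
have := pmin (t', L); rewrite /P /= ht' lL (subset_trans (proper_sub LC1)) // => /(_ isT).
by rewrite leqNgt proper_card.
Qed.

(* The neighbours of the other lobe in t lie in every heavy triple meeting a leaf, so such a
   triple is determined by its vertex in the leaf. *)
Lemma leaf_heavy t C : leaf t C -> exists y1 y2,
  [/\ y1 \in t, y2 \in t & forall t' q, heavy t' -> q \in C ->
   q \in t' -> t' = [set q; y1; y2]].
Proof.
move=> [ht [lC leafC]].
have [C2 lC2 CC2] : exists2 C2, C2 \in lobes (S :\: t) & C != C2.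
  have /card_gt1P[D [D' [lD lD' DD']]] := heavy_two_lobes ht.
  by have [CD|] := eqVneq C D; [exists D'; rewrite ?CD | exists D].
have [w wt] : exists w, w \in t by apply/card_gt0P; case/andP: ht => /eqP->.
(* Excluding an arbitrary vertex first and then [y1] yields two distinct neighbours of [C2] in
   [t]. *)
have [y1 [z1 [y1t _ z1C2 zy1]]] := lobe_neighbour ht w lC2.
have [y2 [z2 [y2t y21 z2C2 zy2]]] := lobe_neighbour ht y1 lC2.
have CsA : C \subset S :\: t by case: (lobeP lC).
have Ct v : v \in C -> v \notin t by move/(subsetP CsA); rewrite inE => /andP[].
exists y1, y2; split=> // t' q ht' qC qt'.
have yt' y z : y \in t -> z \in C2 -> [set z; y] \in B -> y \in t'.
  move=> yt zC2 zy; apply: contraT => yt'.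
  have [|L lL LC] := sublobe ht ht' lC lC2 CC2 _ yt yt' zC2 zy.
    by apply/set0Pn; exists q; rewrite inE qt'.
  by have := leafC t' L ht' lL; rewrite LC.
have qy y : y \in t -> q != y.
  by move=> yt; apply: contraTneq qC => ->; apply/negP => /Ct; rewrite yt.
apply/esym/eqP; rewrite eqEcard; apply/andP; split.
  apply/subsetP => v; rewrite !inE -orbA => /or3P[]/eqP-> //.
    exact: yt' y1t z1C2 zy1.
  exact: yt' y2t z2C2 zy2.
case/andP: ht' => /eqP -> _; rewrite -setUA cardsU1 cards2 !inE negb_or.
by rewrite !qy // eq_sym y21.
Qed.

Definition light v : Prop :=
  (forall X, v \in X -> #|X| = 3%N -> 3 * x X <= 1) /\
  (forall X Y, heavy X -> heavy Y -> v \in X -> v \in Y -> X = Y).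

Lemma leaf_light t C : leaf t C -> exists W : {set V},
  [/\ W \subset C, (1 < #|W|)%N & forall v, v \in W -> light v].
Proof.
move=> lf; have [y1 [y2 [y1t y2t det]]] := leaf_heavy lf.
have [ht [lC _]] := lf; have cC := lobe_card ht lC.
have detv X Y v : v \in C -> heavy X -> heavy Y -> v \in X -> v \in Y -> X = Y.
  by move=> vC hX hY vX vY; rewrite (det X v) // (det Y v).
pose bad := [set v in C | [exists X : {set V}, [&& v \in X, #|X| == 3%N & 1 < 3 * x X]]].
have badP v : v \in bad -> exists2 X, heavy X & v \in X /\ 1 < 3 * x X.
  rewrite inE => /andP[_ /existsP[X /and3P[vX cX xX]]].
  by exists X; rewrite // /heavy cX ltW.
(* Two bad vertices would lie in distinct triples of weight above 1/3, both containing [y1];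
   together with [t] they would cover [y1] more than once. *)
have bad1 : (#|bad| <= 1)%N.
  apply/card_le1_eqP => u v ub vb; apply/eqP/negPn/negP => uv.
  have uC : u \in C by case/setIdP: ub.
  have vC : v \in C by case/setIdP: vb.
  have [X hX [uX xX]] := badP u ub; have [Y hY [vY xY]] := badP v vb.
  have Ct w : w \in C -> w \notin t.
    by case: (lobeP lC) => _ _ /subsetP sC /sC; rewrite inE => /andP[].
  have XE := det X u hX uC uX; have YE := det Y v hY vC vY.
  have XY : X != Y.
    apply/eqP => XY; have : v \in X by rewrite XY.
    rewrite XE !inE (negbTE uv) /= => /orP[]/eqP vy;
      by move: (Ct v vC); rewrite vy ?y1t ?y2t.
  have tX : t != X by apply: contraTneq uX => <-; apply: Ct.
  have tY : t != Y by apply: contraTneq vY => <-; apply: Ct.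
  have y1X : y1 \in X by rewrite XE !inE eqxx orbT.
  have y1Y : y1 \in Y by rewrite YE !inE eqxx orbT.
  have := fx => -[_ _ /(_ y1 (subsetP (heavy_sub ht) _ y1t))].
  rewrite (bigD1 t) //= (bigD1 X) ?y1X 1?eq_sym //= (bigD1 Y) /=; last first.
    by rewrite y1Y eq_sym tY eq_sym XY.
  set rest := \sum_(_ | _) _; have : 0 <= rest by apply: sumr_ge0.
  by have /andP[_] := ht; lra.
exists (C :\: bad); split; first exact: subsetDl.
  have := cardsID bad C; have := subset_leq_card (subsetIr C bad).
  by move: cC bad1; lia.
move=> v /setDP[vC vb]; split=> [X vX cX|X Y hX hY vX vY]; last exact: detv vC hX hY vX vY.
rewrite leNgt; apply: contraNN vb => xX; rewrite inE vC; apply/existsP; exists X.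
by rewrite vX cX eqxx.
Qed.

(** * Charging *)

Let blocks_at v k := [set X : {set V} | [&& x X != 0, v \in X & #|X| == k]].

Lemma sum_blocks_at v (F : {set V} -> R) :
  \sum_(X : {set V} | (x X != 0) && (v \in X)) F X =
  \sum_(X in blocks_at v 1) F X + \sum_(X in blocks_at v 2) F X +
  \sum_(X in blocks_at v 3) F X.
Proof.
rewrite (bigID (fun X : {set V} => #|X| == 3%N)) /= addrC; congr (_ + _); last first.
  by apply: eq_bigl => X; rewrite inE andbA.
rewrite (bigID (fun X : {set V} => #|X| == 2%N)) /= addrC; congr (_ + _).
  apply: eq_bigl => X; rewrite inE; have [xX|//] := boolP (x X != 0).
  have := B_card (x_block xX); have : (0 < #|X|)%N by rewrite card_gt0 x_neq0.
  by case: (v \in X) => //=; case: #|X| => [|[|[|[|n]]]].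
apply: eq_bigl => X; rewrite inE -!andbA; congr (_ && (_ && _)).
by case: #|X| => [|[|[|[|n]]]].
Qed.

Lemma cover_blocks_at v : v \in S ->
  \sum_(X in blocks_at v 1) x X + \sum_(X in blocks_at v 2) x X +
  \sum_(X in blocks_at v 3) x X = 1.
Proof.
move=> vS; rewrite -sum_blocks_at; have [_ _ /(_ v vS) <-] := fx.
rewrite big_mkcond [RHS]big_mkcond; apply: eq_bigr => X _.
by have [->|_] := eqVneq (x X) 0; last by []; case: ifP.
Qed.

Lemma sum_lt (K : {set {set V}}) (a : R) : (forall X, X \in K -> x X < a) ->
  K = set0 \/ \sum_(X in K) x X < a * #|K|%:R.
Proof.
move=> Ka; have [->|[X XK]] := set_0Vmem K; [by left|right].
rewrite mulr_natr -sumr_const; apply: ltr_sum => //.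
by apply/hasP; exists X; rewrite // mem_index_enum.
Qed.

(* A set X of the support gives 6 / #|X| to each of its vertices, plus 2 x X if #|X| < 3.
   The excesses over 6 add up to at most 4 (3 weight x - #|S|) < 6. *)
Definition charge X : R :=
  if #|X| == 3%N then 2 else if #|X| == 2%N then 3 + 2 * x X else 6 + 2 * x X.

Lemma charge_blocks_at v :
  \sum_(X : {set V} | (x X != 0) && (v \in X)) charge X =
  2 * #|blocks_at v 3|%:R + 3 * #|blocks_at v 2|%:R + 6 * #|blocks_at v 1|%:R +
  2 * \sum_(X in blocks_at v 2) x X + 2 * \sum_(X in blocks_at v 1) x X.
Proof.
rewrite sum_blocks_at.
have -> : \sum_(X in blocks_at v 1) charge X =
    6 * #|blocks_at v 1|%:R + 2 * \sum_(X in blocks_at v 1) x X.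
  rewrite mulr_natr -sumr_const mulr_sumr -big_split; apply: eq_bigr => X.
  by rewrite /charge inE => /and3P[_ _ /eqP->].
have -> : \sum_(X in blocks_at v 2) charge X =
    3 * #|blocks_at v 2|%:R + 2 * \sum_(X in blocks_at v 2) x X.
  rewrite mulr_natr -sumr_const mulr_sumr -big_split; apply: eq_bigr => X.
  by rewrite /charge inE => /and3P[_ _ /eqP->].
have -> : \sum_(X in blocks_at v 3) charge X = 2 * #|blocks_at v 3|%:R.
  rewrite mulr_natr -sumr_const; apply: eq_bigr => X.
  by rewrite /charge inE => /and3P[_ _ /eqP->].
lra.
Qed.

Lemma blocks_at_lt v k : #|blocks_at v k| = 0%N /\ \sum_(X in blocks_at v k) x X = 0 \/
  6 * \sum_(X in blocks_at v k) x X < (6 - k%:R) * #|blocks_at v k|%:R.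
Proof.
have [|->|] := @sum_lt (blocks_at v k) ((6 - k%:R) / 6).
- by move=> X; rewrite inE => /and3P[xX _ /eqP Xk]; have := block_weight xX; rewrite Xk; lra.
- by left; rewrite cards0 big_set0.
- by right; lra.
Qed.

Lemma charge_ge v : v \in S ->
  6 <= \sum_(X : {set V} | (x X != 0) && (v \in X)) charge X.
Proof.
move=> vS; rewrite charge_blocks_at.
have pos k : 0 <= \sum_(X in blocks_at v k) x X by apply: sumr_ge0.
apply: (charge_arith (pos 1) (pos 2) (pos 3) (cover_blocks_at vS)).
- by case: (blocks_at_lt v 1) => H; [left|right; lra].
- by case: (blocks_at_lt v 2) => H; [left|right; lra].
- by case: (blocks_at_lt v 3) => H; [left|right; lra].
Qed.

Lemma light_blocks_at v : light v ->
  [\/ #|blocks_at v 3| = 0%N, #|blocks_at v 3| = 1%N /\ 3 * \sum_(X in blocks_at v 3) x X <= 1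
    | (1 < #|blocks_at v 3|)%N /\ 3 * \sum_(X in blocks_at v 3) x X < #|blocks_at v 3|%:R].
Proof.
case=> l1 l2; have le1 X : X \in blocks_at v 3 -> 3 * x X <= 1.
  by rewrite inE => /and3P[_ vX /eqP]; apply: l1.
case cK: #|blocks_at v 3| => [|[|k]]; [by constructor 1|constructor 2|constructor 3].
  split=> //; have /eqP/cards1P[X XE] := cK; rewrite XE big_set1.
  by apply: le1; rewrite XE set11.
split=> //; rewrite -cK -[X in _ < X%:R]sum1_card natr_sum mulr_sumr.
have [X XK xX] : exists2 X, X \in blocks_at v 3 & 3 * x X < 1.
  have /card_gt1P[X [Y [XK YK XY]]] : (1 < #|blocks_at v 3|)%N by rewrite cK.
  have [xX|xX] := ltP (3 * x X) 1; first by exists X.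
  exists Y => //; rewrite ltNge; apply: contraNN XY => xY; apply/eqP.
  move: XK YK; rewrite !inE => /and3P[_ vX cX] /and3P[_ vY cY].
  by apply: l2 vX vY; rewrite /heavy ?cX ?cY.
rewrite (bigD1 X) //= [ltRHS](bigD1 X) //=; apply: ltr_leD => //.
by apply: ler_sum => Y /andP[YK _]; apply: le1.
Qed.

Lemma light_charge_ge v : v \in S -> light v ->
  23 <= 3 * \sum_(X : {set V} | (x X != 0) && (v \in X)) charge X.
Proof.
move=> vS lv; rewrite charge_blocks_at.
have pos k : 0 <= \sum_(X in blocks_at v k) x X by apply: sumr_ge0.
apply: (light_charge_arith (pos 1) (pos 2) (pos 3) (cover_blocks_at vS)).
- by case: (blocks_at_lt v 1) => H; [left|right; lra].
- by case: (blocks_at_lt v 2) => H; [left|right; lra].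
- by case: (blocks_at_lt v 3) => H; [left|right; lra].
- exact: light_blocks_at.
Qed.

Lemma total_charge :
  \sum_(v in S) \sum_(X : {set V} | (x X != 0) && (v \in X)) charge X < 6 * #|S|%:R + 6.
Proof.
have -> : \sum_(v in S) \sum_(X : {set V} | (x X != 0) && (v \in X)) charge X =
    \sum_(X in supp x) #|X|%:R * charge X.
  rewrite (exchange_big_dep (fun X => X \in supp x)) /=; last first.
    by move=> v X _ /andP[]; rewrite inE.
  apply: eq_bigr => X; rewrite inE => xX; rewrite mulr_natl -sumr_const.
  apply: eq_bigl => v; rewrite xX /= andb_idl //; exact: (subsetP (x_sub xX)).
apply: le_lt_trans (_ : 6 * #|supp x|%:R + 4 * (3 * weight x - #|S|%:R) < _); last first.
  have := weight_lt; have : #|supp x|%:R <= #|S|%:R :> R by rewrite ler_nat.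
  by lra.
rewrite -(sum_card fx) /weight mulr_sumr -sumrB mulr_sumr mulr_natr -sumr_const.
rewrite big_mkcond [X in _ <= X + _]big_mkcond -big_split /=; apply: ler_sum => X _.
have [|xX] := ifPn; last first.
  by move: xX; rewrite inE negbK => /eqP->; lra.
rewrite inE => xX; rewrite /charge; have := B_card (x_block xX); have := x_ge0 X.
have : (0 < #|X|)%N by rewrite card_gt0 x_neq0.
(* [#|X| * charge X] equals [6 + 4 * (3 - #|X|) * x X] for sizes 2 and 3 and is at most that for
   size 1. *)
by case: #|X| => [|[|[|[|n]]]] //= _; lra.
Qed.

(** A light vertex receives at least 23/3, which exceeds 6 by 5/3; four of them would give an excess
    of 20/3, more than the 6 that [total_charge] allows. *)
Lemma few_light (W : {set V}) : W \subset S -> (forall v, v \in W -> light v) ->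
  (#|W| <= 3)%N.
Proof.
move=> WS Wl; rewrite leqNgt; apply/negP; rewrite -(ler_nat R) => W4.
have := total_charge; apply/negP; rewrite -leNgt.
have := cardsID W S; have /setIidPr -> := WS; move/(congr1 (@GRing.natmul R 1)).
rewrite natrD => cS.
rewrite (bigID (mem W)) /=.
have -> : \sum_(v in S | v \in W) \sum_(X : {set V} | (x X != 0) && (v \in X)) charge X =
    \sum_(v in W) \sum_(X : {set V} | (x X != 0) && (v \in X)) charge X.
  by apply: eq_bigl => v; rewrite andb_idl //; apply: (subsetP WS).
have : \sum_(v in W) 23 / 3 <=
    \sum_(v in W) \sum_(X : {set V} | (x X != 0) && (v \in X)) charge X.
  apply: ler_sum => v vW.
  by have := light_charge_ge (subsetP WS v vW) (Wl v vW); lra.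
have : \sum_(v in S :\: W) 6 <=
    \sum_(v in S | v \notin W) \sum_(X : {set V} | (x X != 0) && (v \in X)) charge X.
  rewrite (eq_bigl (fun v => (v \in S) && (v \notin W))) => [|v]; last by rewrite inE andbC.
  by apply: ler_sum => v /andP[vS _]; apply: charge_ge.
rewrite !sumr_const -[6 *+ _]mulr_natr -[23 / 3 *+ _]mulr_natr => h1 h2.
lra.
Qed.

(** [tauS] makes [#|S|] odd. Size 1 contradicts weight at least 1. For size 3, [tau S = 2] shows
    that [S] is no block, so all support sets have at most 2 elements and the weight is at least
    3/2. *)
Lemma S_gt3 : (3 < #|S|)%N.
Proof.
rewrite ltnNge; apply/negP => S3.
have oS : odd #|S| by rewrite -[odd _]negbK -oddS -tauS mul2n odd_double.
have := tauS; have := weight_lt; have := card_le_weight B_card fx.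
have c1 v : v \in S -> 1 <= weight x.
  move=> vS; have [_ _ /(_ v vS) <-] := fx; rewrite /weight big_mkcond /=.
  by apply: ler_sum => X _; case: ifP.
case cS: #|S| S3 oS => [|[|[|[|n]]]] // _ _; first last.
  move=> _ w3 t2; have tS : tau S = 2%N by lia.
  have : #|S|%:R <= 2%:R * weight x; last by rewrite cS; lra.
  apply: (weight_ge fx) => X xX; rewrite leqNgt; apply/negP => cX.
  have XS : X = S by apply/eqP; rewrite eqEcard x_sub // cS.
  have := tau_cover B_down B_single (S := S) (P := [set X]); rewrite tS cards1.
  by rewrite sub1set x_block // /cover big_set1 -XS subxx => /(_ isT isT).
move=> _ w1 _; have /eqP/cards1P[v Sv] := cS.
by have := c1 v; rewrite Sv set11 => /(_ isT); lra.
Qed.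

Lemma no_counterexample : False.
Proof.
have [/existsP[t ht]|none] := boolP [exists t, heavy t]; last first.
  have := S_gt3; rewrite ltnNge => /negP; apply; apply: few_light (subxx _) _ => v vS.
  have noh X : ~~ heavy X by apply: contraNN none => hX; apply/existsP; exists X.
  split=> [X vX /eqP cX|X Y hX]; last by have := noh X; rewrite hX.
  by have := noh X; rewrite /heavy cX /= -ltNge => /ltW.
have /card_gt1P[C [D [lC lD CD]]] := heavy_two_lobes ht.
have [t1 [C1 [lf1 C1C]]] := leaf_exists ht lC.
have [t2 [D1 [lf2 D1D]]] := leaf_exists ht lD.
have [W1 [W1C cW1 l1]] := leaf_light lf1.
have [W2 [W2D cW2 l2]] := leaf_light lf2.
have [CA _ CsA] := lobeP lC; have [DA _ DsA] := lobeP lD.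
have CS : C \subset S by apply: subset_trans CsA (subsetDl _ _).
have DS : D \subset S by apply: subset_trans DsA (subsetDl _ _).
have dW : [disjoint W1 & W2].
  apply: disjointWl (subset_trans W1C C1C) _.
  apply: disjointWr (subset_trans W2D D1D) _.
  exact: component_disjoint CA DA CD.
suff : (#|W1 :|: W2| <= 3)%N.
  by move: dW; rewrite -leq_card_setU => /eqP->; rewrite leqNgt (leq_add cW1 cW2).
apply: few_light => [|v].
  rewrite subUset (subset_trans W1C (subset_trans C1C CS)).
  by rewrite (subset_trans W2D (subset_trans D1D DS)).
by rewrite in_setU => /orP[/l1|/l2].
Qed.

End MinimalCounterexample.

Theorem tau_le_weight (R : realFieldType) (V : finType) (B : {set {set V}}) :
  (forall X Y : {set V}, X \in B -> Y \subset X -> Y \in B) ->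
  (forall v, [set v] \in B) -> (forall X : {set V}, X \in B -> (#|X| <= 3)%N) ->
  forall (S : {set V}) (x : {set V} -> R), fractional B S x ->
  6 * (tau B S)%:R <= #|S|%:R + 6 * weight x.
Proof.
move=> Bd B1 B3 S; have [n] := ubnP #|S|; elim: n S => // n IHn S ltn x fx.
rewrite leNgt; apply/negP => counter.
have [y [fy wy sy]] := fractional_sparse fx.
have cy : #|S|%:R + 6 * weight y < 6 * (tau B S)%:R by lra.
apply: (no_counterexample Bd B1 B3 fy sy _ cy) => A z AS fz.
by apply: IHn fz; apply: leq_trans (proper_card AS) _.
Qed.

(** * Ranks of edges and covers by support sets *)

Lemma preference_rank (V : finType) (E : {set {set V}}) (pref : V -> rel {set V}) v e f :
  preference_system E pref -> e \in edges_at E v -> f \in edges_at E v ->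
  (#|[set g in edges_at E v | pref v e g]| <= #|[set g in edges_at E v | pref v f g]|)%N ->
  pref v f e.
Proof.
move=> hpref eE fE; have [rf _ tr tt] := hpref v; apply: contraLR => fe.
have ef : pref v e f by case/orP: (tt _ _ eE fE) => // H; rewrite H in fe.
rewrite -ltnNge; apply/proper_card/properP; split.
  apply/subsetP => g; rewrite !inE => /andP[/andP[gE vg] fg]; rewrite gE vg /=.
  by apply: tr ef fg => //; rewrite inE gE.
by exists e; rewrite !inE; move: (eE); rewrite inE => -> /=; [apply: rf|].
Qed.

Lemma small_cover (R : realFieldType) (V : finType) (x : {set V} -> R) :
  (forall X, 0 <= x X) -> (forall X : {set V}, x X != 0 -> (#|X| <= 3)%N) ->
  exists C : {set {set V}},
    [/\ forall X, X \in C -> x X != 0,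
        forall v, 1 <= \sum_(X : {set V} | v \in X) x X ->
          exists2 X, X \in C & v \in X
      & 6 * #|C|%:R <= #|V|%:R + 6 * weight x].
Proof.
move=> x0 x3; pose S := [set v | 1 <= \sum_(X : {set V} | v \in X) x X].
pose B := [set X : {set V} | (#|X| <= 1)%N ||
  [exists e : {set V}, (x e != 0) && (X \subset e)]].
have Bd (X Y : {set V}) : X \in B -> Y \subset X -> Y \in B.
  rewrite !inE => /orP[X1|/existsP[e /andP[xe Xe]]] YX.
    by rewrite (leq_trans (subset_leq_card YX) X1).
  by apply/orP; right; apply/existsP; exists e; rewrite xe (subset_trans YX).
have B1 v : [set v] \in B by rewrite inE cards1.
have B3 (X : {set V}) : X \in B -> (#|X| <= 3)%N.
  rewrite inE => /orP[/leq_trans-> //|/existsP[e /andP[/x3 e3 Xe]]].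
  exact: leq_trans (subset_leq_card Xe) e3.
have xB (X : {set V}) : x X != 0 -> X \in B.
  by move=> xX; rewrite inE; apply/orP; right; apply/existsP; exists X; rewrite xX /=.
have [|z fz wz] := fractional_exact Bd x0 xB (S := S); first by move=> v; rewrite inE.
have [P pP cP] := tau_packing B1 S.
pose g (X : {set V}) := odflt set0 [pick e : {set V} | (x e != 0) && (X \subset e)].
have gP (X : {set V}) : X \in P -> x (g X) != 0 /\ X \subset g X.
  move=> XP; suff [e xe] : exists e : {set V}, (x e != 0) && (X \subset e).
    by rewrite /g; case: pickP => [f /andP[]//|/(_ e)]; rewrite xe.
  have := packing_in pP XP; rewrite inE => /orP[X1|/existsP//].
  have /cards1P[v Xv] : #|X| == 1%N by rewrite eqn_leq X1 card_gt0 (packing_neq0 pP XP).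
  have : v \in S by apply: (subsetP (packing_sub pP XP)); rewrite Xv set11.
  rewrite inE => /(lt_le_trans ltr01); rewrite lt0r psumr_neq0 => [/andP[/hasP]|//].
  by case=> Y _ /andP[vY /lt0r_neq0 xY] _; exists Y; rewrite xY Xv sub1set.
exists (g @: P); split=> [_ /imsetP[X XP ->]|v vS|]; first by case: (gP X XP).
  have [|X XP vX] := packing_block pP (v := v); first by rewrite inE.
  have [_ Xg] := gP X XP; exists (g X); first exact: imset_f.
  exact: (subsetP Xg).
have := tau_le_weight Bd B1 B3 fz; rewrite -cP.
have : #|g @: P|%:R <= #|P|%:R :> R by rewrite ler_nat leq_imset_card.
by have : #|S|%:R <= #|V|%:R :> R by [rewrite ler_nat max_card]; lra.
Qed.

(** * Stable sets *)

Lemma fractional_stable (V : finType) (E : {set {set V}}) (pref : V -> rel {set V}) :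
  hypergraph E -> uniform 3 E -> preference_system E pref ->
  exists y : {set V} -> rat,
    [/\ forall X, 0 <= y X, forall X, y X != 0 -> X \in E,
        3 * weight y < #|V|%:R + 1
      & forall e, e \in E -> exists v,
          [/\ v \in e, 1 <= \sum_(X : {set V} | v \in X) y X
            & forall f, y f != 0 -> v \in f -> pref v f e]].
Proof.
move=> [V0 E0 _] h3 hpref.
have [v0 _] := card_gt0P V0.
pose eT := {e : {set V} | e \in E}.
pose inc (e : eT) (v : V) := v \in val e.
pose rk (v : V) (e : eT) := #|[set g in edges_at E v | pref v (val e) g]|.
have incE e v : inc e v -> val e \in edges_at E v by move=> ev; rewrite inE (valP e).
have rkP v e f : inc e v -> inc f v -> (rk v e <= rk v f)%N -> pref v (val f) (val e).
  by move=> /incE eE /incE fE; apply: preference_rank.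
have inc_ex e : exists v, inc e v.
  by apply/set0Pn/E0/(valP e).
have rk_inj v e f : inc e v -> inc f v -> rk v e = rk v f -> e = f.
  move=> ev fv ef; apply: val_inj; have [_ anti _ _] := hpref v.
  by apply: anti; rewrite ?incE // !rkP // ef.
(* With this [eps] the perturbation adds up to less than 1 over all vertices. *)
have eps0 : 0 < (#|V|.+1%:R : rat)^-1 by rewrite invr_gt0 ltr0n.
have [b bP nondeg] := generic_rhs (column rat inc) eps0.
have b0 v : 0 < b v by case/andP: (bP v) => /lt_le_trans-> //.
have [|x [x0 xb xP]] := @scarf rat V eT inc rk b inc_ex rk_inj v0 b0.
  by move=> z [_]; apply: nondeg.
(* [x] lives on the subtype of edges; [y] extends it by 0 to all sets of vertices. *)
pose y (X : {set V}) := \sum_(e : eT | val e == X) x e.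
have sum_y (Q : pred {set V}) : \sum_(X | Q X) y X = \sum_(e : eT | Q (val e)) x e.
  rewrite [RHS](partition_big val Q) //=; apply: eq_bigr => X QX.
  by apply: eq_bigl => e; case: eqP => [->|]; rewrite ?QX ?andbF.
have yN0 (X : {set V}) : y X != 0 -> exists2 e, val e = X & x e != 0.
  move=> yX; have [e /andP[/eqP eX xe]] : exists e, (val e == X) && (x e != 0).
    apply/existsP; apply: contraNT yX => /existsPn none; rewrite /y big1 // => e eX.
    by have := none e; rewrite eX /= negbK => /eqP.
  by exists e.
exists y; split=> [X|X /yN0[e <- _]||e eE]; first exact: sumr_ge0.
- exact: valP e.
- rewrite /weight (sum_y predT) mulr_sumr.
  have -> : \sum_(e : eT) 3 * x e = \sum_v \sum_(e | inc e v) x e.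
    rewrite (exchange_big_dep predT) //=; apply: eq_bigr => e _.
    by rewrite sumr_const -(h3 _ (valP e)) mulr_natl; congr (_ *+ _); apply: eq_card.
  apply: le_lt_trans (_ : \sum_v (1 + #|V|.+1%:R^-1) < _).
    by apply: ler_sum => v _; apply: le_trans (xb v) _; case/andP: (bP v).
  rewrite sumr_const -[ltLHS]mulr_natl mulrDr mulr1 ltrD2l.
  by rewrite ltr_pdivrMr ?ltr0n // mul1r ltr_nat.
- have [v [/= ev sat ePv]] := xP (exist _ e eE); exists v; split=> // [|f yf vf].
    by rewrite sum_y sat; case/andP: (bP v).
  have [g gf xg] := yN0 f yf; rewrite -gf; apply: (rkP v (exist _ e eE) g ev).
    by rewrite /inc gf.
  by apply: ePv xg _; rewrite /inc gf.
Qed.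

Local Close Scope ring_scope.

Theorem theorem4p3 (V : finType) (E : {set {set V}}) (pref : V -> rel {set V})
    (hE : hypergraph E) (h3 : uniform 3 E) (hpref : preference_system E pref) :
  exists S : {set {set V}},
    [/\ S \subset E, stable E pref S & 2 * #|S| <= #|V|].
Proof.
have [y [y0 yE wy yst]] := fractional_stable hE h3 hpref.
have [X /yE/h3->//|C [Cy Ccov Cle]] := small_cover y0.
exists C; split; first by apply/subsetP => X /Cy/yE.
  move=> e eE; have [v [ve /Ccov[f fC vf] vpref]] := yst e eE.
  by exists v => //; exists f; split=> //; apply: vpref (Cy f fC) vf.
(* The bounds give [6 * #|C| < 3 * #|V| + 2], while [2 * #|C| >= #|V| + 1] would give
   [6 * #|C| >= 3 * #|V| + 3]. *)
rewrite leqNgt; apply/negP; rewrite -(ler_nat rat) -natr1 natrM => Clt.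
lra.
Qed.
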